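(* Consider problem (P) and suppose that psALMDC applied to (P) does not terminate, so that it generates infinite sequences $\{(x^k,s^k,\sigma_k,\rho_k,\epsilon_k,u^k,v^k)\}_{k\in\mathbb{N}_0}$ and $\{(\lambda^k,\mu^k)\}_{k\ge 1}$. Assume that $\{x^k\}_{k\in\mathbb{N}_0}$ remains bounded and that the feasible set of (P) is nonempty. Then the following statements hold. (i) If $\{\sigma_k\}_{k\in\mathbb{N}_0}$ (or, equivalently, $\{\rho_k\}_{k\in\mathbb{N}_0}$) remains bounded, then for each accumulation point $x^\ast$ of $\{x^k\}_{k\in\mathbb{N}_0}$ there exist $\lambda^\ast\in\mathbb{R}^m$, $\mu^\ast\in\mathbb{R}^p$ such that $(x^\ast,\lambda^\ast,\mu^\ast)$ is a generalized KKT point of (P). In particular, there exists an infinite index set $\overline{K}\subseteq\mathbb{N}_0$ such that $(x^k,\lambda^k,\mu^k)\to(x^\ast,\lambda^\ast,\mu^\ast)$ as $k\to\infty$ with $k\in\overline{K}$. (ii) If $\{\sigma_k\}_{k\in\mathbb{N}_0}$ (or, equivalently, $\{\rho_k\}_{k\in\mathbb{N}_0}$) goes to infinity, then there exists an accumulation point $x^\ast$ of $\{x^k\}_{k\in\mathbb{N}_0}$ which is feasible for (P) and which, provided that mSCQ holds for (P), together with some $\lambda^\ast\in\mathbb{R}^m$, $\mu^\ast\in\mathbb{R}^p$ satisfies the generalized KKT conditions for (P). In particular (in that case), there exists an infinite index set $\overline{K}\subseteq\mathbb{N}_0$ such that $(x^k,\lambda^k,\mu^k)\to(x^\ast,\lambda^\ast,\mu^\ast)$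 as $k\to\infty$ with $k\in\overline{K}$.
   Context: **Problem (P).** $\min_{x\in\mathbb{R}^n} f(x):=g(x)-h(x)$ subject to $Ax=b$, $c(x)\le 0$, $x\in C$, where $g,h:\mathbb{R}^n\to\mathbb{R}$ are convex (real-valued, possibly nonsmooth), $A\in\mathbb{R}^{p\times n}$ with $p\le n$, $b\in\mathbb{R}^p$, $c=(c_1,\dots,c_m)$ with each $c_i:\mathbb{R}^n\to\mathbb{R}$ convex, and $\emptyset\ne C\subseteq\mathbb{R}^n$ closed and convex. Inequalities, $\max$ and $\min$ of vectors are componentwise. $\|\cdot\|$ is the Euclidean norm, $\|x\|_Q:=\sqrt{x^TQx}$ for a symmetric positive definite matrix $Q$, $\partial$ is the convex subdifferential, and $N_C(x):=\{s\mid s^T(y-x)\le 0\ \forall y\in C\}$ for $x\in C$. Put $\ell(x):=Ax-b$. **Generalized KKT point.** $(x^\ast,\lambda^\ast,\mu^\ast)\in\mathbb{R}^n\times\mathbb{R}^m\times\mathbb{R}^p$ is a generalized KKT point of (P) (satisfies the generalized KKT conditions) if $\partial h(x^\ast)\cap\big(\partial g(x^\ast)+\{A^T\mu^\ast\}+\sum_{i=1}^m\lambda_i^\ast\partial c_i(x^\ast)+N_C(x^\ast)\big)\ne\emptyset$; $c_i(x^\ast)\le 0$, $\lambda_i^\ast\ge 0$, $\lambda_i^\ast c_i(x^\ast)=0$ for all $i=1,\dots,m$; $Ax^\ast=b$ and $x^\ast\in C$. **mSCQ** (modified Slater constraint qualification) holds for (P) if there exists $\widetilde{x}\in C$ with $c_i(\widetilde{x})<0$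 for all $i=1,\dots,m$, $A\widetilde{x}=b$, and $0\in\operatorname{int}(\ell(C))$. **Algorithm psALMDC.** For $k\in\mathbb{N}_0$, given $x^k$ and $s^k$, set $$L^{(k)}_\rho(x,\lambda,\mu):=g(x)-h(x^k)-(s^k)^T(x-x^k)+\mu^T(Ax-b)+\tfrac{\rho}{2}\|Ax-b\|^2+\tfrac{1}{2\rho}\big(\|\max\{0,\lambda+\rho c(x)\}\|^2-\|\lambda\|^2\big).$$ (S.0) Let $\{Q_k\}_{k\in\mathbb{N}_0}\subseteq\mathbb{R}^{n\times n}$ be symmetric positive definite with $\underline{\lambda}\le\lambda_{\min}(Q_k)\le\lambda_{\max}(Q_k)\le\overline{\lambda}$ for all $k$ and some $\underline{\lambda},\overline{\lambda}>0$. Choose $(x^0,v^0,u^0)\in\mathbb{R}^n\times\mathbb{R}^p\times\mathbb{R}^m_+$, $\sigma_0,\epsilon_0>0$, $M,N\in\mathbb{N}$ with $N<M$, $\alpha,\beta,\gamma,\theta\in(0,1)$, $\overline{\eta}>1$. Set $\rho_0:=(\sigma_0)^\gamma$, counters $K:=I_1:=0$, and $k:=0$. (S.1) Select $s^k\in\partial h(x^k)$ and compute $x^{k+1}=\operatorname{argmin}_{x\in C}\{L^{(k)}_{\rho_k}(x,u^k,v^k)+\frac{\sigma_k}{2}\|x-x^k\|_{Q_k}^2\}$. (S.2) Set $\mu^{k+1}:=v^k+\rho_k(Ax^{k+1}-b)$ and $\lambda^{k+1}:=\max\{0,u^k+\rho_kc(x^{k+1})\}$. (S.3) If $\sigma_kQ_k(x^{k+1}-x^k)=0$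 and $Ax^{k+1}=b$ and $\min\{-c(x^{k+1}),\lambda^{k+1}\}=0$: STOP. (S.4) (i) If $\|Ax^{k+1}-b\|\le\theta\|Ax^k-b\|$ and $\|\min\{-c(x^{k+1}),u^k/\rho_k\}\|\le\theta\|\min\{-c(x^k),u^{k-1}/\rho_{k-1}\}\|$, set $\sigma_{k+1}:=\sigma_k$, $\rho_{k+1}:=\rho_k$, $\epsilon_{k+1}:=\epsilon_k$. (For $k=0$ the right-hand side of the second test is replaced by an arbitrary fixed nonnegative number.) (ii) Otherwise set $\eta:=\overline{\eta}$ if $\|x^{k+1}-x^k\|^\alpha\ge\epsilon_k$ and $\eta:=1$ otherwise; set $\sigma_{k+1}:=\overline{\eta}\sigma_k$ if $x^{k+1}=x^k$ and $\sigma_{k+1}:=\max\{\|x^{k+1}-x^k\|^{-\alpha},\eta\sigma_k\}$ otherwise; set $\rho_{k+1}:=(\sigma_{k+1})^\gamma$. If $\|x^{k+1}-x^k\|^\alpha<\epsilon_k$, set $K\leftarrow K+1$. If $\sigma_{k+1}=\|x^{k+1}-x^k\|^{-\alpha}$ (regarded as false when $x^{k+1}=x^k$), set $I_1\leftarrow I_1+1$. Then, if $K\ge M$ and $I_1\ge N$, set $\epsilon_{k+1}:=\beta\epsilon_k$, $K\leftarrow 0$, $I_1\leftarrow 0$; else set $\epsilon_{k+1}:=\epsilon_k$. (S.5) Set $v^{k+1}:=v^k$ if $Ax^{k+1}=b$, and $v^{k+1}:=\frac{(v^k)^T(Ax^{k+1}-b)}{\|Ax^{k+1}-b\|^2}(Ax^{k+1}-b)$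 otherwise. Let $I:=\{i\in\{1,\dots,m\}\mid c_i(x^{k+1})>0\}$ and set $u_i^{k+1}:=\frac{(u_I^k)^Tc_I(x^{k+1})}{\|c_I(x^{k+1})\|^2}c_i(x^{k+1})$ for $i\in I$ and $u_i^{k+1}:=u_i^k$ for $i\notin I$ (subscript $I$ denotes restriction to the components in $I$). (S.6) Set $k\leftarrow k+1$ and go to (S.1). *)

(* Defs.v *)
From HB Require Import structures.
From mathcomp Require Import all_boot all_order all_algebra.
From mathcomp Require Import all_classical all_reals all_analysis.

Set Implicit Arguments.
Unset Strict Implicit.
Unset Printing Implicit Defensive.

Import Order.TTheory GRing.Theory Num.Theory.
Import numFieldNormedType.Exports.

Local Open Scope classical_set_scope.
Local Open Scope ring_scope.

(* Vectors of R^n are columns 'cV[R]_n.  Topological notions (closed, interior,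
   cluster points, limits, boundedness) are those of the library, whose norm on
   matrices is the sup norm; every norm that occurs in a formula of the
   algorithm is the Euclidean norm [enorm] below. *)

Section Euclidean.
Context {R : realType} {n : nat}.
Implicit Types (x y s : 'cV[R]_n) (Q : 'M[R]_n) (C : set 'cV[R]_n).

Definition dotv x y : R := (x^T *m y) 0 0.

Definition enorm x : R := Num.sqrt (dotv x x).

Definition qnorm Q x : R := Num.sqrt ((x^T *m Q *m x) 0 0).

Definition sym_posdef Q : Prop :=
  Q^T = Q /\ forall x, x != 0 -> 0 < (x^T *m Q *m x) 0 0.

(* Extreme eigenvalues; meant for symmetric Q, whose spectrum is real. *)
Definition lambda_min Q : R := inf [set a | eigenvalue Q a].
Definition lambda_max Q : R := sup [set a | eigenvalue Q a].

Definition subdiff (f : 'cV[R]_n -> R) x : set 'cV[R]_n :=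
  [set s | forall y, f x + dotv s (y - x) <= f y].

(* Only used at points x of C. *)
Definition normal_cone C x : set 'cV[R]_n :=
  [set s | forall y, C y -> dotv s (y - x) <= 0].

Definition is_argmin C (F : 'cV[R]_n -> R) x : Prop :=
  C x /\ forall y, C y -> F x <= F y.

(* Componentwise maximum and minimum. *)
Definition vmax x y : 'cV[R]_n := map2_mx Num.max x y.
Definition vmin x y : 'cV[R]_n := map2_mx Num.min x y.

End Euclidean.

Record dcProblem (R : realType) (n m p : nat) := DCProblem {
  pg : 'cV[R]_n -> R;
  ph : 'cV[R]_n -> R;
  pA : 'M[R]_(p, n);
  pb : 'cV[R]_p;
  pc : 'cV[R]_n -> 'cV[R]_m;
  pC : set 'cV[R]_n;
  p_le_n : (p <= n)%N;
  pg_convex : @convex_function R 'cV[R]_n setT pg;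
  ph_convex : @convex_function R 'cV[R]_n setT ph;
  pc_convex : forall i : 'I_m,
    @convex_function R 'cV[R]_n setT (fun x => pc x i 0);
  pC_nonempty : pC !=set0;
  pC_closed : closed pC;
  pC_convex : @convex_set R 'cV[R]_n pC
}.

Section Problem.
Context {R : realType} {n m p : nat} (P : dcProblem R n m p).
Local Notation g := (pg P).
Local Notation h := (ph P).
Local Notation A := (pA P).
Local Notation b := (pb P).
Local Notation c := (pc P).
Local Notation C := (pC P).

Definition ell (x : 'cV[R]_n) : 'cV[R]_p := A *m x - b.

Definition feasible : set 'cV[R]_n :=
  [set x | [/\ A *m x = b, forall i, c x i 0 <= 0 & C x]].

Definition generalized_KKT (x : 'cV[R]_n) (lam : 'cV[R]_m) (mu : 'cV[R]_p) :
    Prop :=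
  [/\ exists s sg (sc : 'I_m -> 'cV[R]_n) sn,
        [/\ subdiff h x s, subdiff g x sg,
            forall i, subdiff (fun y => c y i 0) x (sc i),
            normal_cone C x sn &
            s = sg + A^T *m mu + \sum_(i < m) lam i 0 *: sc i + sn],
      forall i, [/\ c x i 0 <= 0, 0 <= lam i 0 & lam i 0 * c x i 0 = 0],
      A *m x = b &
      C x].

Definition mSCQ : Prop :=
  exists xt, [/\ C xt, forall i, c xt i 0 < 0, A *m xt = b &
                 interior (ell @` C) 0].

(* The function L^(k)_rho(x, lam, mu), for x^k = xk and s^k = sk. *)
Definition aug_Lagrangian (xk sk : 'cV[R]_n) (rho : R)
    (x : 'cV[R]_n) (lam : 'cV[R]_m) (mu : 'cV[R]_p) : R :=
  g x - h xk - dotv sk (x - xk) + dotv mu (ell x)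
  + rho / 2 * enorm (ell x) ^+ 2
  + (2 * rho)^-1 *
      (enorm (vmax 0 (lam + rho *: c x)) ^+ 2 - enorm lam ^+ 2).

End Problem.

(* [a_tau] is the arbitrary nonnegative number that replaces, for k = 0, the
   right-hand side of the second test of step (S.4)(i). *)
Record psALMDC_param (R : realType) (n : nat) := PsALMDCParam {
  a_Q : nat -> 'M[R]_n;
  a_lo : R;
  a_hi : R;
  a_M : nat;
  a_N : nat;
  a_alpha : R;
  a_beta : R;
  a_gamma : R;
  a_theta : R;
  a_etabar : R;
  a_tau : R;
  a_Q_posdef : forall k, sym_posdef (a_Q k);
  a_lo_gt0 : 0 < a_lo;
  a_hi_gt0 : 0 < a_hi;
  a_Q_spectrum : forall k,
    a_lo <= lambda_min (a_Q k) /\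
    lambda_min (a_Q k) <= lambda_max (a_Q k) /\
    lambda_max (a_Q k) <= a_hi;
  a_N_gt0 : (0 < a_N)%N;
  a_N_lt_M : (a_N < a_M)%N;
  a_alpha01 : 0 < a_alpha < 1;
  a_beta01 : 0 < a_beta < 1;
  a_gamma01 : 0 < a_gamma < 1;
  a_theta01 : 0 < a_theta < 1;
  a_etabar_gt1 : 1 < a_etabar;
  a_tau_ge0 : 0 <= a_tau
}.

(* [r_K k] and [r_I1 k] are the values of the counters K and I_1 at the start of
   iteration k.  The entries [r_lam 0] and [r_mu 0] are junk: the algorithm
   produces lambda^k and mu^k for k >= 1 only. *)
Record iterates (R : realType) (n m p : nat) := Iterates {
  r_x : nat -> 'cV[R]_n;
  r_s : nat -> 'cV[R]_n;
  r_sigma : nat -> R;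
  r_rho : nat -> R;
  r_eps : nat -> R;
  r_u : nat -> 'cV[R]_m;
  r_v : nat -> 'cV[R]_p;
  r_lam : nat -> 'cV[R]_m;
  r_mu : nat -> 'cV[R]_p;
  r_K : nat -> nat;
  r_I1 : nat -> nat
}.

Section Algorithm.
Context {R : realType} {n m p : nat}.
Variables (P : dcProblem R n m p) (a : psALMDC_param R n)
          (r : iterates R n m p).
Local Notation A := (pA P).
Local Notation b := (pb P).
Local Notation c := (pc P).
Local Notation C := (pC P).
Local Notation Q := (a_Q a).
Local Notation x := (r_x r).
Local Notation s := (r_s r).
Local Notation sigma := (r_sigma r).
Local Notation rho := (r_rho r).
Local Notation eps := (r_eps r).
Local Notation u := (r_u r).
Local Notation v := (r_v r).
Local Notation lam := (r_lam r).
Local Notation mu := (r_mu r).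
Local Notation K := (r_K r).
Local Notation I1 := (r_I1 r).
Local Notation alpha := (a_alpha a).
Local Notation etabar := (a_etabar a).

Definition step0 : Prop :=
  [/\ forall i, 0 <= u 0%N i 0, 0 < sigma 0%N /\ 0 < eps 0%N,
      rho 0%N = sigma 0%N `^ a_gamma a & K 0%N = 0%N /\ I1 0%N = 0%N].

Definition step1 (k : nat) : Prop :=
  subdiff (ph P) (x k) (s k) /\
  is_argmin C
    (fun y => aug_Lagrangian P (x k) (s k) (rho k) y (u k) (v k)
              + sigma k / 2 * qnorm (Q k) (y - x k) ^+ 2)
    (x k.+1).

Definition step2 (k : nat) : Prop :=
  mu k.+1 = v k + rho k *: (A *m x k.+1 - b) /\
  lam k.+1 = vmax 0 (u k + rho k *: c (x k.+1)).

Definition stops (k : nat) : Prop :=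
  [/\ sigma k *: (Q k *m (x k.+1 - x k)) = 0,
      A *m x k.+1 = b &
      vmin (- c (x k.+1)) (lam k.+1) = 0].

Definition step_length (k : nat) : R := enorm (x k.+1 - x k).

Definition compl_residual (k : nat) : R :=
  enorm (vmin (- c (x k.+1)) ((rho k)^-1 *: u k)).

Definition sufficient_progress (k : nat) : bool :=
  (enorm (A *m x k.+1 - b) <= a_theta a * enorm (A *m x k - b)) &&
  (compl_residual k <=
     if k is j.+1 then a_theta a * compl_residual j else a_tau a).

Definition step4i (k : nat) : Prop :=
  [/\ sigma k.+1 = sigma k, rho k.+1 = rho k, eps k.+1 = eps k,
      K k.+1 = K k & I1 k.+1 = I1 k].

(* [K1] and [J1] are the counters K and I_1 after their increments and before
   their possible reset. *)
Definition step4ii (k : nat) : Prop :=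
  let d := step_length k in
  let eta := if d `^ alpha >= eps k then etabar else 1 in
  let K1 := if d `^ alpha < eps k then (K k).+1 else K k in
  let J1 := if (x k.+1 != x k) && (sigma k.+1 == d `^ (- alpha))
            then (I1 k).+1 else I1 k in
  let reset := (a_M a <= K1)%N && (a_N a <= J1)%N in
  [/\ sigma k.+1 = (if x k.+1 == x k then etabar * sigma k
                    else Num.max (d `^ (- alpha)) (eta * sigma k)),
      rho k.+1 = sigma k.+1 `^ a_gamma a,
      eps k.+1 = (if reset then a_beta a * eps k else eps k),
      K k.+1 = (if reset then 0%N else K1) &
      I1 k.+1 = (if reset then 0%N else J1)].

Definition step4 (k : nat) : Prop :=
  if sufficient_progress k then step4i k else step4ii k.

Definition step5 (k : nat) : Prop :=
  let res := A *m x k.+1 - b in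
  let c1 := c (x k.+1) in
  let uc := \sum_(j < m | 0 < c1 j 0) u k j 0 * c1 j 0 in
  let cc := \sum_(j < m | 0 < c1 j 0) c1 j 0 ^+ 2 in
  v k.+1 = (if A *m x k.+1 == b then v k
            else (dotv (v k) res / enorm res ^+ 2) *: res) /\
  u k.+1 = \col_(i < m)
             (if 0 < c1 i 0 then uc / cc * c1 i 0 else u k i 0).

(* The sequences [r] are generated by psALMDC without termination. *)
Definition psALMDC_generates : Prop :=
  step0 /\
  forall k, [/\ step1 k, step2 k, ~ stops k, step4 k & step5 k].

End Algorithm.

(* (x^k, lambda^k, mu^k) tends to (xs, ls, ms) as k tends to infinity in J. *)
Definition converges_along (R : realType) (n m p : nat) (r : iterates R n m p)
    (J : set nat) (xs : 'cV[R]_n) (ls : 'cV[R]_m) (ms : 'cV[R]_p) : Prop :=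
  [/\ r_x r k @[k --> within J \oo] --> xs,
      r_lam r k @[k --> within J \oo] --> ls &
      r_mu r k @[k --> within J \oo] --> ms].

(* Main.v *)
Require Import Defs.
From HB Require Import structures.
From mathcomp Require Import all_boot all_order all_algebra.
From mathcomp Require Import all_classical all_reals all_analysis.
From mathcomp Require Import ring lra.

(** Let [d k] be the length of the step from [x k] to [x k.+1].

    Optimality of [x k.+1] in its subproblem is a variational inequality over
    [C] in which the updated multipliers [lam k.+1] and [mu k.+1] occur
    linearly and the proximal term contributes a vector of length at most a
    multiple of [sigma k * d k] ([run_VI]).  Where this product tends to 0 and
    the multipliers stay bounded, the inequality passes to the limit: the limit
    point minimises over [C] a finite sum of convex functions, and the sum rule
    for subdifferentials ([subdiff_sum_rule], from a Hahn-Banach separation)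
    splits this into the inclusion of the generalized KKT conditions
    ([KKT_of_VI], [KKT_of_limit]).  Limits are taken along ultrafilters finer
    than the cofinite filter; an index set is extracted at the end only.

    The steps vanish in both cases by descent of the augmented Lagrangian of the
    difference-of-convex objective.  The update of the multipliers [u] and [v] is
    an orthogonal projection that leaves the value of this function unchanged and
    does not lengthen the multipliers, and a step lowers the value by a multiple
    of [sigma k * d k ^+ 2] ([run_descent]).  When [sigma] is bounded, so is the
    increase due to [rho], and the lengths are square summable; when [sigma] tends
    to infinity, the value is of order [rho = sigma `^ gamma], which is small
    compared with [sigma].

    When [sigma] is bounded, vanishing steps exclude all but finitely many changes
    of the penalty parameter, since each one multiplies [sigma] by a constant
    greater than 1 or makes it at least [d k `^ (- alpha)].  So both residual
    tests succeed from some index on, the residuals tend to 0 geometrically, and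
    the multipliers are bounded because [rho] is.

    When [sigma] tends to infinity, infinitely many steps satisfy
    [sigma k <= d k `^ (- alpha)] or are null; otherwise the counters would freeze
    [eps], after which the vanishing steps would leave [sigma] constant.  Along
    these steps [sigma k * d k <= d k `^ (1 - alpha)] tends to 0.  The variational
    inequality tested with a feasible point then bounds [rho] times the squared
    constraint violation, so the limit is feasible; tested with the Slater point
    it bounds [lam], and tested with points of [C] whose residuals are small
    multiples of the unit vectors it bounds [mu]. *)

Import Order.TTheory GRing.Theory Num.Theory.
Import numFieldNormedType.Exports.

Local Open Scope classical_set_scope.
Local Open Scope ring_scope.
Set Implicit Arguments.
Unset Strict Implicit.

(** * Inner product and Euclidean norm *)

Section InnerProduct.
Context {R : realType} {n : nat}.
Implicit Types (x y z s : 'cV[R]_n) (t : R).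

Lemma dotvE x y : dotv x y = \sum_i x i 0 * y i 0.
Proof. by rewrite /dotv mxE; apply: eq_bigr => i _; rewrite mxE. Qed.

Lemma dotvC x y : dotv x y = dotv y x.
Proof. by rewrite !dotvE; apply: eq_bigr => i _; rewrite mulrC. Qed.

Lemma dotvDl x y z : dotv (x + y) z = dotv x z + dotv y z.
Proof. by rewrite /dotv linearD mulmxDl mxE. Qed.

Lemma dotvDr x y z : dotv x (y + z) = dotv x y + dotv x z.
Proof. by rewrite /dotv mulmxDr mxE. Qed.

Lemma dotvZl t x y : dotv (t *: x) y = t * dotv x y.
Proof. by rewrite /dotv linearZ /= -scalemxAl mxE. Qed.

Lemma dotvZr t x y : dotv x (t *: y) = t * dotv x y.
Proof. by rewrite dotvC dotvZl dotvC. Qed.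

Lemma dotvNl x y : dotv (- x) y = - dotv x y.
Proof. by rewrite -scaleN1r dotvZl mulN1r. Qed.

Lemma dotvNr x y : dotv x (- y) = - dotv x y.
Proof. by rewrite dotvC dotvNl dotvC. Qed.

Lemma dotvBl x y z : dotv (x - y) z = dotv x z - dotv y z.
Proof. by rewrite dotvDl dotvNl. Qed.

Lemma dotvBr x y z : dotv x (y - z) = dotv x y - dotv x z.
Proof. by rewrite dotvDr dotvNr. Qed.

Lemma dotv0l x : dotv 0 x = 0.
Proof. by rewrite -(scale0r x) dotvZl mul0r. Qed.

Lemma dotv0r x : dotv x 0 = 0.
Proof. by rewrite dotvC dotv0l. Qed.

Lemma dotv_suml (I : finType) (F : I -> 'cV[R]_n) x :
  dotv (\sum_i F i) x = \sum_i dotv (F i) x.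
Proof.
apply: (big_morph (fun y => dotv y x)) => [y z|]; first exact: dotvDl.
exact: dotv0l.
Qed.

Lemma dotv_ge0 x : 0 <= dotv x x.
Proof. by rewrite dotvE sumr_ge0 // => i _; rewrite -expr2 sqr_ge0. Qed.

Lemma sqr_coord_le_dotv x i : x i 0 ^+ 2 <= dotv x x.
Proof.
rewrite dotvE (bigD1 i) //= expr2 lerDl sumr_ge0 // => j _.
by rewrite -expr2 sqr_ge0.
Qed.

Lemma dotv_eq0 x : (dotv x x == 0) = (x == 0).
Proof.
apply/eqP/eqP => [x0|->]; last exact: dotv0l.
apply/matrixP => i j; rewrite (ord1 j) !mxE; apply/eqP.
by rewrite -sqrf_eq0 eq_le sqr_ge0 andbT -x0 sqr_coord_le_dotv.
Qed.

Lemma enorm_sqr x : enorm x ^+ 2 = dotv x x.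
Proof. by rewrite /enorm sqr_sqrtr // dotv_ge0. Qed.

Lemma enorm_ge0 x : 0 <= enorm x.
Proof. exact: sqrtr_ge0. Qed.

Lemma enorm_eq0 x : (enorm x == 0) = (x == 0).
Proof. by rewrite -dotv_eq0 -enorm_sqr sqrf_eq0. Qed.

Lemma coord_le_enorm x i : `|x i 0| <= enorm x.
Proof.
rewrite -ler_sqr ?nnegrE ?enorm_ge0 ?normr_ge0 //.
by rewrite enorm_sqr real_normK ?num_real // sqr_coord_le_dotv.
Qed.

(** Pythagoras: the residual of an orthogonal projection is orthogonal to the
    projected vector. *)
Lemma dotv_proj_le x y : dotv (x - y) y = 0 -> dotv y y <= dotv x x.
Proof.
move=> xy0; have := dotv_ge0 (x - y).
rewrite dotvBr xy0 subr0 dotvBl => h.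
move: xy0; rewrite dotvBl (dotvC y x) in h * => xy0; lra.
Qed.

Lemma subdiff0 x s : subdiff (fun=> 0 : R) x s -> s = 0.
Proof.
move=> /(_ (x + s)); rewrite add0r addrAC subrr add0r => s0.
by apply/eqP; rewrite -dotv_eq0 eq_le s0 dotv_ge0.
Qed.

End InnerProduct.

(** * Convex functions on finite-dimensional space *)

Section Convexity.
Context {R : realType}.

(** The weights are reals rather than elements of the unit-interval type, to
    stay within reach of the ring and order tactics. *)
Definition convexf (E : lmodType R) (f : E -> R) :=
  forall t x y, 0 <= t <= 1 ->
    f (t *: x + (1 - t) *: y) <= t * f x + (1 - t) * f y.

Definition convexs (E : lmodType R) (C : set E) :=
  forall t x y, 0 <= t <= 1 -> C x -> C y -> C (t *: x + (1 - t) *: y).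

Lemma convex_functionP n (f : 'cV[R]_n -> R) :
  @convex_function R 'cV[R]_n setT f -> convexf f.
Proof.
move=> cf t x y /andP[t0 t1].
by have := cf (Itv01 t0 t1) x y; rewrite !in_setT => /(_ isT isT).
Qed.

Lemma convex_setP n (C : set 'cV[R]_n) :
  @convex_set R 'cV[R]_n C -> convexs C.
Proof.
move=> cC t x y /andP[t0 t1] Cx Cy; apply: set_mem.
by have := cC x y (Itv01 t0 t1); apply; apply/mem_set.
Qed.

Lemma convexf_sum (E : lmodType R) (I : finType) (F : I -> E -> R) :
  (forall i, convexf (F i)) -> convexf (fun x => \sum_i F i x).
Proof.
move=> cF t x y t01; rewrite !mulr_sumr -big_split /=.
by apply: ler_sum => i _; apply: cF.
Qed.

Lemma convexf_scale (E : lmodType R) (l : R) (f : E -> R) :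
  0 <= l -> convexf f -> convexf (fun x => l * f x).
Proof.
move=> l0 cf t x y t01; apply: le_trans (ler_wpM2l l0 (cf t x y t01)) _.
by rewrite le_eqVlt; apply/predU1l; ring.
Qed.

Lemma convexf_le2 (E : lmodType R) (f : E -> R) (a b : R) (x y : E) :
  convexf f -> 0 < a -> 0 < b ->
  (a + b) * f ((a + b)^-1 *: (a *: x + b *: y)) <= a * f x + b * f y.
Proof.
move=> cf a0 b0; have ab0 : 0 < a + b by apply: addr_gt0.
have := cf (a / (a + b)) x y.
have -> : 0 <= a / (a + b) <= 1.
  apply/andP; split; first by rewrite divr_ge0 ?ltW.
  by rewrite ler_pdivrMr ?mul1r ?lerDl ?ltW.
have -> : 1 - a / (a + b) = b / (a + b) by field; rewrite gt_eqF.
move=> /(_ isT); rewrite scalerDr !scalerA ![(a + b)^-1 * _]mulrC => h.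
apply: le_trans (ler_wpM2l (ltW ab0) h) _.
by rewrite le_eqVlt; apply/predU1l; field; rewrite gt_eqF.
Qed.

(** One coordinate at a time: a point of the box lies on a segment between two
    points whose [i]-th displacement is extreme. *)
Lemma convexf_box_ub n (f : 'cV[R]_n -> R) (T : R) (x : 'cV[R]_n) :
  convexf f -> 0 < T ->
  exists B, forall d : 'cV[R]_n, (forall i, `|d i 0| <= T) -> f (x + d) <= B.
Proof.
move=> cf T0.
suff H (s : seq 'I_n) y : exists B, forall d : 'cV[R]_n,
    (forall i, i \notin s -> d i 0 = 0) -> (forall i, `|d i 0| <= T) ->
    f (y + d) <= B.
  have [B HB] := H (enum 'I_n) x; exists B => d; apply: HB => i.
  by rewrite mem_enum.
elim: s y => [|i s IH] y.
  exists (f y) => d d0 _; suff -> : d = 0 by rewrite addr0.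
  by apply/matrixP => i j; rewrite (ord1 j) mxE d0.
pose e : 'cV[R]_n := T *: delta_mx i 0.
have [[B1 H1] [B2 H2]] := (IH (y + e), IH (y - e)).
exists (Num.max B1 B2) => d ds dT.
pose d' := d - d i 0 *: delta_mx i 0.
have d'E j : d' j 0 = if j == i then 0 else d j 0.
  rewrite !mxE eqxx andbT; case: (j =P i) => [->|_] /=; first by rewrite mulr1 subrr.
  by rewrite mulr0 subr0.
have d's j : j \notin s -> d' j 0 = 0.
  rewrite d'E; case: (j =P i) => [//|/eqP ji js].
  by apply: ds; rewrite inE negb_or ji.
have d'T j : `|d' j 0| <= T.
  by rewrite d'E; case: ifP => // _; rewrite normr0 ltW.
have := dT i; rewrite ler_norml => /andP[dl du].
pose w := (1 + d i 0 / T) / 2.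
have wE : d i 0 = (2 * w - 1) * T by rewrite /w; field; rewrite gt_eqF.
have w01 : 0 <= w <= 1.
  have dlT : -1 <= d i 0 / T by rewrite ler_pdivlMr // mulN1r.
  have duT : d i 0 / T <= 1 by rewrite ler_pdivrMr // mul1r.
  by rewrite /w; apply/andP; split; lra.
have -> : y + d = w *: (y + e + d') + (1 - w) *: (y - e + d').
  apply/matrixP => j k; rewrite (ord1 k) !mxE eqxx andbT.
  by case: (j =P i) => [->|_] /=; rewrite ?wE /=; ring.
apply: le_trans (cf _ _ _ w01) _.
have := H1 _ d's d'T; have := H2 _ d's d'T.
have B1M : B1 <= Num.max B1 B2 by rewrite le_max lexx.
have B2M : B2 <= Num.max B1 B2 by rewrite le_max lexx orbT.
move: w01 B1M B2M => /andP[w0 w1]; move: (Num.max _ _) => M.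
by move=> *; nra.
Qed.

Lemma convexf_bounded n (f : 'cV[R]_n -> R) (T : R) :
  convexf f ->
  exists M, forall x : 'cV[R]_n, (forall i, `|x i 0| <= T) -> `|f x| <= M.
Proof.
move=> cf; have T1 : 0 < `|T| + 1 by rewrite ltr_wpDl.
have [B HB] := convexf_box_ub 0 cf T1.
exists (`|B| + 2 * `|f 0|) => x xT.
have xT1 i : `|x i 0| <= `|T| + 1.
  by apply: le_trans (xT i) _; apply: le_trans (ler_norm _) _; rewrite lerDl.
have NxT1 i : `|(- x) i 0| <= `|T| + 1 by rewrite mxE normrN.
have := HB _ xT1; have := HB _ NxT1; rewrite !add0r.
have := @convexf_le2 _ f 1 1 x (- x) cf ltr01 ltr01.
rewrite !scale1r subrr scaler0 !mul1r => h1 h2 h3.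
have := ler_norm B; have := ler_norm (- f 0); rewrite normrN.
by have := normr_ge0 (f 0); rewrite ler_norml => *; apply/andP; split; lra.
Qed.

(** Around [x] the function is at most [B] on the unit box, and convexity
    scales the resulting one-sided bounds down linearly with the box. *)
Lemma convexf_local_lipschitz n (f : 'cV[R]_n -> R) (x : 'cV[R]_n) :
  convexf f ->
  exists2 L, 0 < L & forall (r : R) (d : 'cV[R]_n), 0 < r <= 1 ->
    (forall i, `|d i 0| <= r) -> `|f (x + d) - f x| <= r * L.
Proof.
move=> cf; have [B HB] := convexf_box_ub x cf ltr01.
have Bf : f x <= B.
  by rewrite -[x in f x]addr0; apply: HB => i; rewrite mxE normr0.
exists (B - f x + 1) => [|r d /andP[r0 r1] dr]; first by lra.
pose d1 := r^-1 *: d.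
have d1T i : `|d1 i 0| <= 1.
  by rewrite mxE normrM normfV (gtr0_norm r0) mulrC ler_pdivrMr // mul1r.
have Nd1T i : `|(- d1) i 0| <= 1 by rewrite mxE normrN.
have := HB _ d1T; have := HB _ Nd1T.
have := cf r (x + d1) x; rewrite (ltW r0) r1 => /(_ isT).
have -> : r *: (x + d1) + (1 - r) *: x = x + d.
  by apply/matrixP => i j; rewrite !mxE; field; rewrite gt_eqF.
have := @convexf_le2 _ f 1 r (x + d) (x - d1) cf ltr01 r0.
have -> : (1 + r)^-1 *: (1 *: (x + d) + r *: (x - d1)) = x.
  apply/matrixP => i j; rewrite !mxE; field.
  by rewrite !gt_eqF // ltr_wpDl // ltW.
by rewrite ler_norml => *; apply/andP; split; nra.
Qed.

(** The subgradient inequality at [x + e] and [x - e], for a unit vector [e],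
    bounds a coordinate of the subgradient by the oscillation of [f]. *)
Lemma subdiff_bounded n (f : 'cV[R]_n -> R) (T : R) :
  convexf f ->
  exists M, forall x s : 'cV[R]_n, (forall i, `|x i 0| <= T) ->
    subdiff f x s -> forall i, `|s i 0| <= M.
Proof.
move=> cf; have [M HM] := convexf_bounded (T + 1) cf.
exists (2 * M) => x s xT sx i.
have step (e : R) : `|e| <= 1 -> e * s i 0 <= 2 * M.
  move=> e1; have := sx (x + e *: delta_mx i 0).
  have -> : dotv s (x + e *: delta_mx i 0 - x) = e * s i 0.
    rewrite addrAC subrr add0r dotvZr dotvE (bigD1 i) //= big1 => [|j ji].
      by rewrite mxE !eqxx mulr1 addr0.
    by rewrite mxE (negbTE ji) mulr0.
  have xT1 j : `|x j 0| <= T + 1 by apply: le_trans (xT j) _; rewrite lerDl.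
  have yT1 j : `|(x + e *: delta_mx i 0) j 0| <= T + 1.
    rewrite !mxE; apply: le_trans (ler_normD _ _) _; apply: lerD => //.
    by rewrite normrM -[leRHS]mul1r ler_pM // normr_nat lern1 leq_b1.
  have := HM _ xT1; have := HM _ yT1; rewrite !ler_norml.
  move=> /andP[_ yu] /andP[xl _]; lra.
have := step 1; have := step (-1).
rewrite normrN1 normr1 => /(_ (lexx _)) + /(_ (lexx _)).
by rewrite ler_norml => *; apply/andP; split; lra.
Qed.

End Convexity.

(** * Hahn-Banach separation and the subdifferential sum rule *)

Section HahnBanach.
Context {R : realType} {E : lmodType R}.
Implicit Types (p q : E -> R) (x y e w : E).

(** An inequality for positive factors is enough: applied to [t] and to its
    inverse it gives positive homogeneity. *)
Definition sublinear q :=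
  (forall x y, q (x + y) <= q x + q y) /\
  (forall t x, 0 < t -> q (t *: x) <= t * q x).

Lemma sublinearZ q t x : sublinear q -> 0 < t -> q (t *: x) = t * q x.
Proof.
move=> [_ qZ] t0; apply/eqP; rewrite eq_le qZ //=.
have tV0 : 0 < t^-1 by rewrite invr_gt0.
have := qZ t^-1 (t *: x) tV0; rewrite scalerA mulVf ?gt_eqF // scale1r => h.
by have := ler_wpM2l (ltW t0) h; rewrite mulrA divff ?gt_eqF // mul1r.
Qed.

Lemma sublinear0 q : sublinear q -> q 0 = 0.
Proof.
move=> sq; have := @sublinearZ q 2 0 sq (ltr0n _ 2); rewrite scaler0; lra.
Qed.

Lemma sublinear_ge_opp q x : sublinear q -> - q (- x) <= q x.
Proof.
by move=> sq; have := sq.1 x (- x); rewrite subrr (sublinear0 sq); lra.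
Qed.

Section MakeLinearAlong.
Variables (q : E -> R) (e : E).
Hypothesis sq : sublinear q.

Let S w := [set z | exists2 t, 0 <= t & z = q (w + t *: e) - t * q e].
Let q' w := inf (S w).

Let S_ge w t : 0 <= t -> - q (- w) <= q (w + t *: e) - t * q e.
Proof.
rewrite le_eqVlt => /orP[/eqP <-|t0].
  by rewrite scale0r addr0 mul0r subr0 sublinear_ge_opp.
have := sq.1 (w + t *: e) (- w).
rewrite [w + _]addrC addrK (sublinearZ _ sq t0); lra.
Qed.

Let q'_le w t : 0 <= t -> q' w <= q (w + t *: e) - t * q e.
Proof.
move=> t0; apply: ge_inf; last by exists t.
by exists (- q (- w)) => _ [r r0 ->]; apply: S_ge.
Qed.

Let q'_ge w z : (forall t, 0 <= t -> z <= q (w + t *: e) - t * q e) -> z <= q' w.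
Proof.
move=> h; apply: lb_le_inf => [|_ [t t0 ->]]; last exact: h.
by exists (q w), 0 => //; rewrite scale0r addr0 mul0r subr0.
Qed.

(** Replacing [q] by its infimal slope along [e] gives a smaller sublinear
    function that is linear on the line of [e]. *)
Lemma sublinear_linear_along :
  exists q1, [/\ sublinear q1, forall w, q1 w <= q w & q1 (- e) <= - q1 e].
Proof.
exists q'; split.
- split=> [x y|t x t0].
    suff h t1 t2 : 0 <= t1 -> 0 <= t2 -> q' (x + y) <=
        (q (x + t1 *: e) - t1 * q e) + (q (y + t2 *: e) - t2 * q e).
      rewrite -lerBlDr; apply: q'_ge => t1 t10.
      rewrite lerBlDl -lerBlDr; apply: q'_ge => t2 t20.
      by rewrite lerBlDl; apply: h.
    move=> t10 t20; apply: le_trans (q'_le _ (addr_ge0 t10 t20)) _.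
    have := sq.1 (x + t1 *: e) (y + t2 *: e).
    by rewrite addrACA -scalerDl; lra.
  rewrite mulrC -ler_pdivrMr //; apply: q'_ge => r r0.
  rewrite ler_pdivrMr //; apply: le_trans (q'_le _ (mulr_ge0 (ltW t0) r0)) _.
  rewrite -scalerA -scalerDr (sublinearZ _ sq t0).
  by rewrite le_eqVlt; apply/predU1l; ring.
- by move=> w; apply: le_trans (q'_le _ (lexx 0)) _;
    rewrite scale0r addr0 mul0r subr0.
- have e1 : q' (- e) <= - q e.
    have := q'_le (- e) ler01.
    by rewrite scale1r addNr (sublinear0 sq) mul1r add0r.
  apply: le_trans e1 _; rewrite lerN2.
  have := q'_le e (lexx 0); by rewrite scale0r addr0 mul0r subr0.
Qed.

End MakeLinearAlong.

Lemma sublinear_linear_along_seq p (s : seq E) : sublinear p ->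
  exists q, [/\ sublinear q, forall w, q w <= p w &
    {in s, forall e, q (- e) <= - q e}].
Proof.
move=> sp; elim: s => [|e s [q [sq qp qs]]]; first by exists p.
have [q1 [sq1 q1q q1e]] := sublinear_linear_along e sq.
exists q1; split => // [w|f]; first exact: le_trans (q1q w) (qp w).
rewrite inE => /predU1P[->//|fs].
(* below [q], linearity along [f] is inherited *)
apply: le_trans (q1q _) _; apply: le_trans (qs _ fs) _.
by rewrite lerN2.
Qed.

Lemma sublinear_sum (I : finType) q (F : I -> E) : sublinear q ->
  q (\sum_i F i) <= \sum_i q (F i).
Proof.
move=> sq; elim/big_ind2: _ => [|x1 y1 x2 y2 h1 h2|//].
  by rewrite (sublinear0 sq).
by apply: le_trans (sq.1 _ _) (lerD h1 h2).
Qed.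

Lemma sublinear_line q e t : sublinear q -> q (- e) <= - q e ->
  q (t *: e) = t * q e.
Proof.
move=> sq qe; case: (ltrgtP t 0) => [t0|t0|->].
- have qe' : q (- e) = - q e.
    by apply/eqP; rewrite eq_le qe /= lerNl sublinear_ge_opp.
  have t0' : 0 < - t by rewrite oppr_gt0.
  by rewrite -[t]opprK scaleNr -scalerN (sublinearZ _ sq t0') qe'; ring.
- exact: sublinearZ.
- by rewrite scale0r sublinear0 // mul0r.
Qed.

End HahnBanach.

Section SumRule.
Context {R : realType}.

Definition mxdot m n (L W : 'M[R]_(m, n)) := \sum_i \sum_j L i j * W i j.

Lemma hahn_banach_mx m n (p : 'M[R]_(m, n) -> R) : sublinear p ->
  exists L, forall W, mxdot L W <= p W.
Proof.
move=> sp.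
pose s : seq 'M[R]_(m, n) :=
  [seq delta_mx ij.1 ij.2 | ij <- enum [the finType of ('I_m * 'I_n)%type]].
have [q [sq qp qs]] := sublinear_linear_along_seq s sp.
have qline t i j : q (t *: delta_mx i j) = t * q (delta_mx i j).
  apply: sublinear_line => //; apply: qs; apply/mapP.
  by exists (i, j) => //; rewrite mem_enum.
exists (\matrix_(i, j) q (delta_mx i j)) => W.
have qW V : q V <= mxdot (\matrix_(i, j) q (delta_mx i j)) V.
  rewrite {1}[V]matrix_sum_delta; apply: le_trans (sublinear_sum _ sq) _.
  apply: ler_sum => i _; apply: le_trans (sublinear_sum _ sq) _.
  by apply: ler_sum => j _; rewrite mxE qline mulrC.
apply: le_trans (qp W); apply: le_trans (sublinear_ge_opp _ sq).
rewrite lerNr; apply: le_trans (qW _) _.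
rewrite /mxdot -sumrN; apply: ler_sum => i _.
by rewrite -sumrN; apply: ler_sum => j _; rewrite !mxE mulrN.
Qed.

(** The function [p w = inf {a * Psi (d + w / a) | a > 0, d in D}] is sublinear,
    lies below [Psi] and is nonpositive on [- D]; a linear functional below [p]
    therefore separates. *)
Lemma convex_separation m n (Psi : 'M[R]_(m, n) -> R) (D : set 'M[R]_(m, n)) :
  convexf Psi -> convexs D -> D 0 -> Psi 0 = 0 ->
  (forall d, D d -> 0 <= Psi d) ->
  exists L, (forall W, mxdot L W <= Psi W) /\ (forall d, D d -> 0 <= mxdot L d).
Proof.
move=> cPsi cD D0 Psi0 PsiD.
pose S (w : 'M[R]_(m, n)) := [set z | exists (a : R) d,
  [/\ 0 < a, D d & z = a * Psi (d + a^-1 *: w)]].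
pose p (w : 'M[R]_(m, n)) : R := inf (S w).
have sum2 (a1 a2 : R) d1 d2 (w1 w2 : 'M[R]_(m, n)) : 0 < a1 -> 0 < a2 -> D d1 -> D d2 ->
    exists2 d, D d & (a1 + a2) * Psi (d + (a1 + a2)^-1 *: (w1 + w2)) <=
      a1 * Psi (d1 + a1^-1 *: w1) + a2 * Psi (d2 + a2^-1 *: w2).
  move=> a10 a20 Dd1 Dd2; have a0 := addr_gt0 a10 a20.
  exists ((a1 / (a1 + a2)) *: d1 + (1 - a1 / (a1 + a2)) *: d2).
    apply: cD => //; apply/andP; split; first by rewrite divr_ge0 ?ltW.
    by rewrite ler_pdivrMr ?mul1r ?lerDl ?ltW.
  apply: le_trans (convexf_le2 _ _ cPsi a10 a20).
  rewrite le_eqVlt; apply/predU1l; congr (_ * Psi _).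
  by apply/matrixP => i j; rewrite !mxE; field; rewrite !gt_eqF.
have S_ge (w : 'M[R]_(m, n)) (a : R) d : 0 < a -> D d ->
    - Psi (- w) <= a * Psi (d + a^-1 *: w).
  move=> a0 Dd; have [d' Dd'] := sum2 a 1 d 0 w (- w) a0 ltr01 Dd D0.
  rewrite subrr scaler0 addr0 add0r invr1 scale1r mul1r.
  have : 0 <= (a + 1) * Psi d' by rewrite mulr_ge0 ?PsiD // addr_ge0 ?ltW.
  lra.
have p_le (w : 'M[R]_(m, n)) (a : R) d : 0 < a -> D d -> p w <= a * Psi (d + a^-1 *: w).
  move=> a0 Dd; apply: ge_inf; last by exists a, d.
  by exists (- Psi (- w)) => _ [b [d' [b0 Dd' ->]]]; apply: S_ge.
have p_ge (w : 'M[R]_(m, n)) (z : R) :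
    (forall (a : R) d, 0 < a -> D d -> z <= a * Psi (d + a^-1 *: w)) ->
    z <= p w.
  move=> h; apply: lb_le_inf => [|_ [a [d [a0 Dd ->]]]]; last exact: h.
  by exists (Psi w), 1, 0; rewrite invr1 scale1r mul1r add0r.
have sp : sublinear p.
  split=> [x y|t x t0].
    rewrite -lerBlDr; apply: (p_ge _ _) => a1 d1 a10 Dd1.
    rewrite lerBlDl -lerBlDr; apply: p_ge => a2 d2 a20 Dd2.
    rewrite lerBlDl; have [d Dd] := sum2 _ _ _ _ x y a10 a20 Dd1 Dd2.
    by apply: le_trans; apply: p_le => //; apply: addr_gt0.
  rewrite mulrC -ler_pdivrMr //; apply: p_ge => a d a0 Dd.
  rewrite ler_pdivrMr //; apply: le_trans (p_le _ (t * a) d _ Dd) _.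
    exact: mulr_gt0.
  rewrite scalerA; have -> : (t * a)^-1 * t = a^-1 by field; rewrite !gt_eqF.
  by rewrite le_eqVlt; apply/predU1l; ring.
have [L HL] := hahn_banach_mx sp; exists L; split=> [W|d Dd].
  apply: le_trans (HL W) _; have := p_le W 1 0 ltr01 D0.
  by rewrite invr1 scale1r mul1r add0r.
have := le_trans (HL (- d)) (p_le (- d) 1 d ltr01 Dd).
rewrite invr1 scale1r mul1r subrr Psi0.
suff -> : mxdot L (- d) = - mxdot L d by rewrite oppr_le0.
rewrite /mxdot -sumrN; apply: eq_bigr => i _; rewrite -sumrN.
by apply: eq_bigr => j _; rewrite mxE mulrN.
Qed.

(** Giving each summand its own displacement, a column of a matrix, turns the
    minimality of the sum into a convex function that is nonnegative on the
    matrices with equal columns; the columns of a separating functional are the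
    subgradients. *)
Lemma subdiff_sum_rule n q (F : 'I_q -> 'cV[R]_n -> R) (C : set 'cV[R]_n)
    (x : 'cV[R]_n) :
  (forall j, convexf (F j)) -> convexs C -> C x ->
  (forall y, C y -> \sum_j F j x <= \sum_j F j y) ->
  exists S : 'I_q -> 'cV[R]_n, (forall j, subdiff (F j) x (S j)) /\
    normal_cone C x (- \sum_j S j).
Proof.
move=> cF cC Cx Fmin.
pose diag (d : 'cV[R]_n) : 'M[R]_(n, q) := \matrix_(i, j) d i 0.
pose D := [set M | exists2 y, C y & M = diag (y - x)].
pose Psi (M : 'M[R]_(n, q)) := \sum_j (F j (x + col j M) - F j x).
have mxdotE L (M : 'M[R]_(n, q)) : mxdot L M = \sum_j dotv (col j L) (col j M).
  rewrite /mxdot exchange_big; apply: eq_bigr => j _.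
  by rewrite dotvE; apply: eq_bigr => i _; rewrite !mxE.
have coldiag j d : col j (diag d) = d.
  by apply/matrixP => i k; rewrite !mxE (ord1 k).
have cPsi : convexf Psi.
  apply: convexf_sum => j t M N t01.
  have -> : x + col j (t *: M + (1 - t) *: N) =
      t *: (x + col j M) + (1 - t) *: (x + col j N).
    by apply/matrixP => i k; rewrite !mxE; ring.
  by have := cF j t (x + col j M) (x + col j N) t01; lra.
have cD : convexs D.
  move=> t _ _ t01 [y1 Cy1 ->] [y2 Cy2 ->].
  exists (t *: y1 + (1 - t) *: y2); first exact: cC.
  by apply/matrixP => i k; rewrite !mxE; ring.
have D0 : D 0.
  by exists x => //; apply/matrixP => i k; rewrite !mxE subrr.
have Psi0 : Psi 0 = 0.
  apply: big1 => j _; suff -> : col j (0 : 'M[R]_(n, q)) = 0 by rewrite addr0 subrr.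
  by apply/matrixP => i k; rewrite !mxE.
have PsiD d : D d -> 0 <= Psi d.
  move=> [y Cy ->]; rewrite /Psi sumrB subr_ge0.
  under [leRHS]eq_bigr do rewrite coldiag addrC subrK.
  exact: Fmin.
have [L [Lle Lge]] := convex_separation cPsi cD D0 Psi0 PsiD.
exists (fun j => col j L); split=> [j y|y Cy].
  pose M : 'M[R]_(n, q) := \matrix_(i, k) if k == j then (y - x) i 0 else 0.
  have colM k : col k M = if k == j then y - x else 0.
    by apply/matrixP => i l; rewrite !mxE (ord1 l); case: (k == j); rewrite !mxE.
  have := Lle M; rewrite mxdotE /Psi (bigD1 j) //= big1 => [|k kj]; last first.
    by rewrite colM (negbTE kj) dotv0r.
  rewrite [leRHS](bigD1 j) //= [X in _ <= _ + X]big1 => [|k kj]; last first.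
    by rewrite colM (negbTE kj) addr0 subrr.
  by rewrite colM eqxx !addr0 [x + _]addrC subrK; lra.
have /Lge : D (diag (y - x)) by exists y.
rewrite mxdotE dotvNl oppr_le0 dotv_suml.
by under eq_bigr do rewrite coldiag.
Qed.

Lemma subdiff_nonempty n (f : 'cV[R]_n -> R) x : convexf f -> subdiff f x !=set0.
Proof.
move=> cf; have [||||S [HS _]] := @subdiff_sum_rule n 1 (fun=> f) [set x] x.
- by [].
- move=> t _ _ _ -> ->; rewrite /= -scalerDl addrC subrK scale1r //.
- by [].
- by move=> _ ->.
by exists (S 0); apply: HS.
Qed.

(** For [l = 0] the scaled function has only the subgradient 0, and any
    subgradient of [f] will do. *)
Lemma subdiff_scale n (f : 'cV[R]_n -> R) (l : R) x s :
  convexf f -> 0 <= l -> subdiff (fun y => l * f y) x s ->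
  exists2 s', subdiff f x s' & s = l *: s'.
Proof.
move=> cf; rewrite le_eqVlt => /orP[/eqP <-|l0] hs.
  have [s' hs'] := subdiff_nonempty x cf; exists s' => //.
  rewrite scale0r; apply: subdiff0 (x) _ _ => y.
  by have := hs y; rewrite !mul0r.
exists (l^-1 *: s); last by rewrite scalerA divff ?gt_eqF // scale1r.
move=> y; rewrite -(ler_pM2l l0) mulrDr dotvZl mulrA divff ?gt_eqF // mul1r.
exact: hs.
Qed.

End SumRule.

(** * Limits along filters *)

Section Limits.
Context {R : realType} {I : Type} {F : set_system I} {FF : ProperFilter F}.

Lemma cvg_colP n (x : I -> 'cV[R]_n) (l : 'cV[R]_n) :
  (x k @[k --> F] --> l) <-> (forall i, x k i 0 @[k --> F] --> l i 0).
Proof.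
split=> [xl i|xl A [P Pl PA]].
  exact: (continuous_cvg _ (@coord_continuous R n 1 i 0 l)).
have : \forall k \near F, forall i, P i 0 (x k i 0).
  by apply: filter_forall => i; apply: xl; apply: Pl.
apply: filterS => k Pk; apply: PA => i j; rewrite (ord1 j); exact: Pk.
Qed.

Lemma cvg_sumr (J : finType) (f : J -> I -> R) (l : J -> R) :
  (forall j, f j k @[k --> F] --> l j) ->
  \sum_j f j k @[k --> F] --> \sum_j l j.
Proof.
move=> fl; elim: (index_enum J) => [|j s IH].
  under eq_fun do rewrite big_nil.
  by rewrite big_nil; apply: cvg_cst.
under eq_fun do rewrite big_cons.
by rewrite big_cons; apply: cvgD.
Qed.

Lemma cvg_dotv n (x y : I -> 'cV[R]_n) (lx ly : 'cV[R]_n) :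
  x k @[k --> F] --> lx -> y k @[k --> F] --> ly ->
  dotv (x k) (y k) @[k --> F] --> dotv lx ly.
Proof.
move=> /cvg_colP xl /cvg_colP yl; rewrite dotvE.
under eq_fun do rewrite dotvE.
by apply: cvg_sumr => i; apply: cvgM.
Qed.

Lemma cvg_mulmx m n (A : 'M[R]_(m, n)) (x : I -> 'cV[R]_n) (l : 'cV[R]_n) :
  x k @[k --> F] --> l -> A *m x k @[k --> F] --> A *m l.
Proof.
move=> /cvg_colP xl; apply/cvg_colP => i; rewrite mxE.
under eq_fun do rewrite mxE.
by apply: cvg_sumr => j; apply: cvgM => //; apply: cvg_cst.
Qed.

Lemma cvg_convexf n (f : 'cV[R]_n -> R) (x : I -> 'cV[R]_n) (l : 'cV[R]_n) :
  convexf f -> x k @[k --> F] --> l -> f (x k) @[k --> F] --> f l.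
Proof.
move=> cf /cvg_colP xl; have [L L0 HL] := convexf_local_lipschitz l cf.
apply/cvgrPdist_le => e e0; pose r := Num.min 1 (e / L).
have r0 : 0 < r by rewrite lt_min ltr01 divr_gt0.
have : \forall k \near F, forall i, `|l i 0 - x k i 0| <= r.
  by apply: filter_forall => i; move/cvgrPdist_le: (xl i); apply.
apply: filterS => k xk; rewrite distrC.
have -> : x k = l + (x k - l) by rewrite addrC subrK.
apply: le_trans (HL r _ _ _) _ => [|i|].
- by rewrite r0 ge_min lexx.
- by rewrite !mxE distrC.
- by rewrite -ler_pdivlMr // ge_min lexx orbT.
Qed.

Lemma squeeze0 (f g : I -> R) : (\forall k \near F, `|f k| <= g k) ->
  g k @[k --> F] --> 0 -> f k @[k --> F] --> 0.
Proof.
move=> fg /cvgrPdist_le g0; apply/cvgrPdist_le => e e0.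
apply: filterS2 fg (g0 e e0) => k h; rewrite !sub0r !normrN.
by apply: le_trans; apply: le_trans h _; apply: ler_norm.
Qed.

Lemma cvg0_mul_bounded (f g : I -> R) (B : R) :
  (\forall k \near F, `|f k| <= B) -> g k @[k --> F] --> 0 ->
  f k * g k @[k --> F] --> 0.
Proof.
move=> fB g0; apply: (@squeeze0 _ (fun k => B * `|g k|)).
  by apply: filterS fB => k fk; rewrite normrM ler_wpM2r.
suff : B * `|g k| @[k --> F] --> B * `|0 : R| by rewrite normr0 mulr0.
by apply: cvgM; [apply: cvg_cst|apply: cvg_norm].
Qed.

End Limits.

Lemma cvg_finer (T : Type) (V : topologicalType) (F G : set_system T)
  (f : T -> V) (l : V) : F `<=` G -> f k @[k --> F] --> l -> f k @[k --> G] --> l.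
Proof. by move=> FG fl A /fl; apply: FG. Qed.

Section Ultra.
Context {R : realType} {I : Type} {U : set_system I} {FU : UltraFilter U}.

(** Ultrafilters stand in for subsequences: along a single one every bounded
    sequence converges. *)
Lemma ultra_cvg_bounded (f : I -> R) (B : R) :
  (\forall k \near U, `|f k| <= B) -> exists l : R, f k @[k --> U] --> l.
Proof.
move=> fB; have [|l [_ cl]] := @segment_compact R (- B) B (f k @[k --> U]) _.
  by apply: filterS fB => k; rewrite ler_norml /= in_itv.
exists l => A lA; have [//|UnA] := in_ultra_setVsetC (f @^-1` A) FU.
have [y [/= nAy Ay]] := cl (~` A) A UnA lA; by case: nAy.
Qed.

Lemma ultra_cvg_bounded_col n (x : I -> 'cV[R]_n) :
  (forall i, exists B : R, \forall k \near U, `|x k i 0| <= B) ->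
  exists l : 'cV[R]_n, x k @[k --> U] --> l.
Proof.
move=> xB; have xl i : exists l : R, x k i 0 @[k --> U] --> l.
  by have [B xiB] := xB i; apply: ultra_cvg_bounded xiB.
have [l {}xl] := choice xl.
by exists (\col_i l i); apply/cvg_colP => i; rewrite mxE.
Qed.

End Ultra.

(** * Rayleigh quotients of symmetric matrices *)

Section Rayleigh.
Context {R : realType} {n : nat}.
Implicit Types (S : 'M[R]_n) (x y : 'cV[R]_n).

Lemma dotv_mulmx_tr m (A : 'M[R]_(m, n)) (y : 'cV[R]_m) x :
  dotv y (A *m x) = dotv (A^T *m y) x.
Proof. by rewrite /dotv trmx_mul trmxK mulmxA. Qed.

Lemma dotv_sym S x y : S^T = S -> dotv x (S *m y) = dotv y (S *m x).
Proof. by move=> St; rewrite dotv_mulmx_tr St dotvC. Qed.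

(** If a positive semidefinite form vanishes at [x], its first variation there,
    in the direction [y], vanishes too. *)
Lemma psd_null S x : S^T = S -> (forall y, 0 <= dotv y (S *m y)) ->
  dotv x (S *m x) = 0 -> S *m x = 0.
Proof.
move=> St Sge Sx; apply/eqP; rewrite -dotv_eq0; apply/eqP.
set y := S *m x; pose c := dotv y (S *m y).
have c0 : 0 <= c by apply: Sge.
have h t : 0 <= 2 * t * dotv y y + t ^+ 2 * c.
  have := Sge (x + t *: y); rewrite mulmxDr -scalemxAr !dotvDl !dotvDr.
  rewrite !dotvZl !dotvZr Sx (dotv_sym x y St) -/y -/c.
  by rewrite expr2 mulrA; lra.
have := h (- (dotv y y) / (c + 1)); have d0 := dotv_ge0 y.
have -> : 2 * (- dotv y y / (c + 1)) * dotv y y + (- dotv y y / (c + 1)) ^+ 2 * c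
   = - (dotv y y ^+ 2 * ((c + 2) / (c + 1) ^+ 2)).
  by field; rewrite gt_eqF // ltr_wpDl.
rewrite oppr_ge0 pmulr_lle0; last by rewrite divr_gt0 ?exprn_gt0 //; lra.
by move=> y0; apply/eqP; rewrite -sqrf_eq0 eq_le y0 sqr_ge0.
Qed.

(** A minimiser of the Rayleigh quotient on the unit sphere, found as a limit of
    a minimising sequence, is an eigenvector for the minimum. *)
Lemma rayleigh_min S : (0 < n)%N -> S^T = S ->
  exists2 a, eigenvalue S a & forall y, a * dotv y y <= dotv y (S *m y).
Proof.
move=> n0 St.
pose V := [set z | exists2 x, dotv x x = 1 & z = dotv x (S *m x)].
have V0 : V !=set0.
  exists (dotv (delta_mx (Ordinal n0) 0) (S *m delta_mx (Ordinal n0) 0)).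
  exists (delta_mx (Ordinal n0) 0) => //.
  rewrite dotvE (bigD1 (Ordinal n0)) //= big1 => [|i /negbTE in0].
    by rewrite !mxE !eqxx mulr1 addr0.
  by rewrite mxE in0 mul0r.
have Vlb : has_lbound V.
  exists (- \sum_i \sum_j `|S i j|) => _ [x x1 ->].
  have xb i : `|x i 0| <= 1.
    by apply: le_trans (coord_le_enorm x i) _; rewrite /enorm x1 sqrtr1.
  rewrite dotvE -sumrN; apply: ler_sum => i _.
  rewrite mxE mulr_sumr -sumrN; apply: ler_sum => j _.
  rewrite lerNl; apply: le_trans (ler_norm _) _; rewrite normrN !normrM.
  rewrite mulrCA -[leRHS]mulr1 ler_wpM2l //.
  by rewrite mulr_ile1.
pose a := inf V.
have ae k : exists x, dotv x x = 1 /\ dotv x (S *m x) < a + k.+1%:R^-1.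
  have [||_ [x x1 ->] xa] := @inf_adherent R V k.+1%:R^-1; last by exists x.
    by rewrite invr_gt0.
  by split.
have [x /all_and2 [x1 xa]] := choice ae.
have [U [UU nU]] := @ultraFilterLemma nat \oo _.
have [i|l xl] := @ultra_cvg_bounded_col R nat U UU n x.
  exists 1; apply: nearW => k; apply: le_trans (coord_le_enorm _ i) _.
  by rewrite /enorm x1 sqrtr1.
have l1 : dotv l l = 1.
  have h : dotv (x k) (x k) @[k --> U] --> dotv l l by apply: cvg_dotv.
  have h1 : dotv (x k) (x k) @[k --> U] --> (1 : R).
    by under eq_fun do rewrite x1; apply: cvg_cst.
  by apply: cvg_unique h h1; apply: norm_hausdorff.
have la : dotv l (S *m l) <= a.
  apply: (ler_cvg_to (cvg_dotv xl (cvg_mulmx xl)) (g := fun k => a + k.+1%:R^-1)).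
    rewrite -[X in _ --> X]addr0; apply: cvgD; first exact: cvg_cst.
    apply: cvg_finer nU _; exact: cvg_harmonic.
  by apply: nearW => k; apply/ltW.
have ale y : a * dotv y y <= dotv y (S *m y).
  have [->|y0] := eqVneq y 0; first by rewrite mulmx0 !dotv0r mulr0.
  have ey : 0 < enorm y by rewrite lt_def enorm_eq0 y0 enorm_ge0.
  have : a <= dotv ((enorm y)^-1 *: y) (S *m ((enorm y)^-1 *: y)).
    apply: ge_inf => //; exists ((enorm y)^-1 *: y) => //.
    by rewrite dotvZl dotvZr mulrA -expr2 -enorm_sqr -exprMn mulVf ?gt_eqF ?expr1n.
  rewrite -scalemxAr dotvZl dotvZr mulrA -expr2 exprVn mulrC.
  by rewrite ler_pdivlMr ?exprn_gt0 // enorm_sqr.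
have Bl : (S - a%:M) *m l = 0.
  have BE y : dotv y ((S - a%:M) *m y) = dotv y (S *m y) - a * dotv y y.
    by rewrite mulmxBl mul_scalar_mx dotvBr dotvZr.
  apply: psd_null.
  - by rewrite linearB /= St tr_scalar_mx.
  - by move=> y; rewrite BE subr_ge0.
  - rewrite BE l1 mulr1; apply/eqP; rewrite eq_le subr_le0 la subr_ge0.
    by rewrite -[a]mulr1 -l1 ale.
exists a => //; apply/eigenvalueP; exists l^T.
  move: Bl; rewrite mulmxBl mul_scalar_mx => /subr0_eq /(congr1 trmx).
  by rewrite trmx_mul St linearZ.
apply/eqP => /(congr1 trmx); rewrite trmxK trmx0 => l0.
by move: l1; rewrite l0 dotv0r => /esym/eqP; rewrite oner_eq0.
Qed.

Lemma eigenvalue_rayleigh S b : S^T = S -> eigenvalue S b ->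
  exists2 x, 0 < dotv x x & dotv x (S *m x) = b * dotv x x.
Proof.
move=> St /eigenvalueP[v vS v0]; exists v^T.
  by rewrite lt_def dotv_eq0 dotv_ge0 andbT -(inj_eq (@trmx_inj _ _ _)) trmxK trmx0.
by rewrite -dotvZr; congr dotv; move/(congr1 trmx): vS; rewrite trmx_mul St linearZ.
Qed.

Lemma lambda_min_le S y : S^T = S -> lambda_min S * dotv y y <= dotv y (S *m y).
Proof.
move=> St; case: (posnP n) => [n0|n0].
  have -> : y = 0 by apply/matrixP => i; have := ltn_ord i; rewrite {2}n0.
  by rewrite mulmx0 !dotv0r mulr0.
have [a Sa ale] := rayleigh_min n0 St.
apply: le_trans (ale y); apply: ler_wpM2r; first exact: dotv_ge0.
apply: ge_inf => //; exists a => b /(eigenvalue_rayleigh St) [x x0 xb].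
by rewrite -(ler_pM2r x0) -xb.
Qed.

Lemma lambda_max_ge S y : S^T = S -> dotv y (S *m y) <= lambda_max S * dotv y y.
Proof.
move=> St; have StN : (- S)^T = - S by rewrite linearN /= St.
case: (posnP n) => [n0|n0].
  have -> : y = 0 by apply/matrixP => i; have := ltn_ord i; rewrite {2}n0.
  by rewrite mulmx0 !dotv0r mulr0.
have [a Sa ale] := rayleigh_min n0 StN.
have aleS z : dotv z (S *m z) <= - a * dotv z z.
  by have := ale z; rewrite mulNmx dotvNr; lra.
apply: le_trans (aleS y) _; apply: ler_wpM2r; first exact: dotv_ge0.
apply: ub_le_sup.
  exists (- a) => b /(eigenvalue_rayleigh St) [x x0 xb].
  by rewrite -(ler_pM2r x0) -xb.
move/eigenvalueP: Sa => [v vS v0]; apply/eigenvalueP; exists v => //.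
by move: vS; rewrite mulmxN scaleNr => <-; rewrite opprK.
Qed.

(** With [e] the [i]-th unit vector and [d1] the normalised [d], the form is
    nonnegative at [e + d1] and at [e - d1]; expanding bounds its value at the
    pair of [e] and [d1]. *)
Lemma psd_coord_le S (hi : R) d i : S^T = S ->
  (forall y, 0 <= dotv y (S *m y)) ->
  (forall y, dotv y (S *m y) <= hi * dotv y y) ->
  `|(S *m d) i 0| <= hi * enorm d.
Proof.
move=> St Sge Sle; have [->|d0] := eqVneq d 0.
  by rewrite mulmx0 mxE normr0 /enorm dotv0r sqrtr0 mulr0.
have ed : 0 < enorm d by rewrite lt_def enorm_eq0 d0 enorm_ge0.
pose e : 'cV[R]_n := delta_mx i 0.
have eE z : dotv e z = z i 0.
  rewrite dotvE (bigD1 i) //= big1 => [|j ji]; first by rewrite mxE !eqxx mul1r addr0.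
  by rewrite mxE (negbTE ji) mul0r.
have ee : dotv e e = 1 by rewrite eE mxE !eqxx.
pose d1 := (enorm d)^-1 *: d.
have dd1 : dotv d1 d1 = 1.
  by rewrite dotvZl dotvZr mulrA -expr2 -enorm_sqr -exprMn mulVf ?gt_eqF ?expr1n.
have dE : (S *m d) i 0 = enorm d * dotv e (S *m d1).
  by rewrite -scalemxAr dotvZr mulrA divff ?gt_eqF // mul1r eE.
rewrite dE normrM (gtr0_norm ed) mulrC ler_pM2r //.
have := Sge (e - d1); have := Sge (e + d1); have := Sle e; have := Sle d1.
rewrite ee dd1 mulr1 mulmxBr mulmxDr !dotvBl !dotvBr !dotvDl !dotvDr.
rewrite (dotv_sym d1 e St) ler_norml => *; apply/andP; split; lra.
Qed.

End Rayleigh.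

(** * The augmented Lagrangian and its subproblem *)

Section Penalty.
Context {R : realType}.
Implicit Types rho u c : R.

(** The contribution of one inequality constraint to the augmented
    Lagrangian. *)
Definition penalty rho u c : R :=
  (2 * rho)^-1 * (Num.max 0 (u + rho * c) ^+ 2 - u ^+ 2).

(** Elimination of a slack variable: [w] minimises [u * w + rho / 2 * w ^+ 2]
    over the half-line [w >= c], and the penalty is the least value. *)
Lemma penalty_slackE rho u c : 0 < rho ->
  let w := Num.max c (- (u / rho)) in
  penalty rho u c = u * w + rho / 2 * w ^+ 2.
Proof.
move=> rho0 /=; rewrite /penalty.
have rn : rho != 0 by rewrite gt_eqF.
have [h|h] := leP c (- (u / rho)).
  have -> : Num.max 0 (u + rho * c) = 0.
    apply/max_idPl; move: h; rewrite -mulNr ler_pdivlMr //; lra.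
  by field.
have -> : Num.max 0 (u + rho * c) = u + rho * c.
  apply/max_idPr; move: h; rewrite -mulNr ltr_pdivrMr //; lra.
by field.
Qed.

Lemma penalty_le_rho rho1 rho2 u c : 0 <= u -> 0 < rho1 -> rho1 <= rho2 ->
  penalty rho2 u c <= penalty rho1 u c +
    (rho2 - rho1) * (c ^+ 2 + (u / rho1) ^+ 2).
Proof.
move=> u0 r10 r12; have r20 : 0 < rho2 by apply: lt_le_trans r12.
rewrite !penalty_slackE //=.
set w1 := Num.max c (- (u / rho1)); set w2 := Num.max c (- (u / rho2)).
have w1c : c <= w1 by rewrite le_max lexx.
have w1b : w1 ^+ 2 <= c ^+ 2 + (u / rho1) ^+ 2.
  rewrite /w1; have [_|_] := leP c (- (u / rho1)).
    by rewrite sqrrN lerDr sqr_ge0.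
  by rewrite lerDl sqr_ge0.
have w2min : u * w2 + rho2 / 2 * w2 ^+ 2 <= u * w1 + rho2 / 2 * w1 ^+ 2.
  have -> : u = rho2 * (u / rho2) by field; rewrite gt_eqF.
  rewrite /w2; move: (u / rho2) => z; have [h|h] := leP c (- z).
    have : 0 <= rho2 / 2 * (w1 + z) ^+ 2.
      by rewrite mulr_ge0 ?sqr_ge0 // divr_ge0 // ltW.
    by lra.
  have : 0 <= rho2 / 2 * ((w1 - c) * (w1 + c + 2 * z)).
    rewrite mulr_ge0 ?divr_ge0 ?(ltW r20) // mulr_ge0 ?subr_ge0 //; lra.
  by lra.
have : (rho2 - rho1) / 2 * w1 ^+ 2 <= (rho2 - rho1) * (c ^+ 2 + (u / rho1) ^+ 2).
  rewrite -mulrA ler_wpM2l ?subr_ge0 //; have := sqr_ge0 w1; lra.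
by lra.
Qed.

Lemma penalty_ge rho u c : 0 < rho -> - (u ^+ 2 / (2 * rho)) <= penalty rho u c.
Proof.
move=> rho0; have -> : - (u ^+ 2 / (2 * rho)) = (2 * rho)^-1 * (0 - u ^+ 2).
  by field; rewrite gt_eqF.
rewrite /penalty ler_pM2l ?invr_gt0 ?mulr_gt0 //.
by rewrite lerD2r sqr_ge0.
Qed.

Lemma penalty_incr rho u c c' z : 0 < rho -> c' <= c + z ->
  penalty rho u c' <=
    penalty rho u c + Num.max 0 (u + rho * c) * z + rho / 2 * z ^+ 2.
Proof.
move=> rho0 cz; set m := Num.max 0 (u + rho * c).
have h : Num.max 0 (u + rho * c') ^+ 2 <= (m + rho * z) ^+ 2.
  have [_|c'0] := leP (u + rho * c') 0; first by rewrite expr0n sqr_ge0.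
  have mc : u + rho * c <= m by rewrite le_max lexx orbT.
  have : rho * c' <= rho * (c + z) by rewrite ler_pM2l.
  by move=> *; rewrite ler_sqr ?nnegrE; lra.
rewrite /penalty -/m -subr_ge0.
have -> : (2 * rho)^-1 * (m ^+ 2 - u ^+ 2) + m * z + rho / 2 * z ^+ 2
    - (2 * rho)^-1 * (Num.max 0 (u + rho * c') ^+ 2 - u ^+ 2)
  = (2 * rho)^-1 * ((m + rho * z) ^+ 2 - Num.max 0 (u + rho * c') ^+ 2).
  by field; rewrite gt_eqF.
by rewrite mulr_ge0 ?invr_ge0 ?subr_ge0 // mulr_ge0 // ltW.
Qed.

Lemma penalty_violated rho u c : 0 < rho -> 0 <= u -> 0 <= c ->
  penalty rho u c = u * c + rho / 2 * c ^+ 2.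
Proof.
move=> rho0 u0 c0; rewrite penalty_slackE //=.
suff -> : Num.max c (- (u / rho)) = c by [].
by apply/max_idPl; apply: le_trans c0; rewrite oppr_le0 divr_ge0 // ltW.
Qed.

Lemma ge0_of_linear_term (a b : R) :
  (forall t, 0 < t <= 1 -> 0 <= t * a + t ^+ 2 * b) -> 0 <= a.
Proof.
move=> h; rewrite leNgt; apply/negP => a0.
have q0 : 0 < `|b| + 1 by rewrite ltr_wpDl.
pose t := Num.min 1 (- a / 2 / (`|b| + 1)).
have t0 : 0 < t by rewrite lt_min ltr01 !divr_gt0 // oppr_gt0.
have tb : t * (`|b| + 1) <= - a / 2 by rewrite -ler_pdivlMr // ge_min lexx orbT.
have := h t; rewrite t0 ge_min lexx => /(_ isT).
have -> : t * a + t ^+ 2 * b = t * (a + t * b) by ring.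
rewrite pmulr_rge0 // => h1.
have : t * b <= t * (`|b| + 1) by rewrite ler_pM2l // ler_wpDr // ler_norm.
lra.
Qed.

End Penalty.

Section Subproblem.
Context {R : realType} {n m p : nat} (P : dcProblem R n m p).
Local Notation g := (pg P).
Local Notation h := (ph P).
Local Notation A := (pA P).
Local Notation b := (pb P).
Local Notation c := (pc P).
Local Notation C := (pC P).

(** The augmented Lagrangian of the problem itself, in which the concave part of
    the objective is not linearised. *)
Definition dc_Lagrangian rho (x : 'cV[R]_n) (u : 'cV[R]_m) (v : 'cV[R]_p) : R :=
  g x - h x + dotv v (ell P x) + rho / 2 * dotv (ell P x) (ell P x)
  + \sum_i penalty rho (u i 0) (c x i 0).

Lemma penalty_sumE rho (u z : 'cV[R]_m) :
  (2 * rho)^-1 * (enorm (vmax 0 (u + rho *: z)) ^+ 2 - enorm u ^+ 2) =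
  \sum_i penalty rho (u i 0) (z i 0).
Proof.
rewrite !enorm_sqr !dotvE -sumrB mulr_sumr; apply: eq_bigr => i _.
by rewrite !mxE -!expr2.
Qed.

Lemma aug_LagrangianE xk sk rho x u v :
  aug_Lagrangian P xk sk rho x u v =
  g x - h xk - dotv sk (x - xk) + dotv v (ell P x)
  + rho / 2 * dotv (ell P x) (ell P x) + \sum_i penalty rho (u i 0) (c x i 0).
Proof. by rewrite /aug_Lagrangian enorm_sqr penalty_sumE. Qed.

Lemma qnorm_sqr (Q : 'M[R]_n) x : 0 <= dotv x (Q *m x) ->
  qnorm Q x ^+ 2 = dotv x (Q *m x).
Proof. by move=> h0; rewrite /qnorm -mulmxA sqr_sqrtr. Qed.

Section OneStep.
Variables (xk sk x1 : 'cV[R]_n) (rho sigma : R) (u : 'cV[R]_m) (v : 'cV[R]_p)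
  (Q : 'M[R]_n).
Hypotheses (rho0 : 0 < rho) (Qsym : Q^T = Q)
  (Qpsd : forall y, 0 <= dotv y (Q *m y)).
Hypothesis x1min : is_argmin C
  (fun y => aug_Lagrangian P xk sk rho y u v
            + sigma / 2 * qnorm Q (y - xk) ^+ 2) x1.

(** Along the segment from the minimiser [x1] to [y], the objective of the
    subproblem grows by at most [t] times the right-hand side plus a multiple
    of [t ^+ 2]. *)
Lemma subproblem_VI y : C y ->
  0 <= g y - g x1 - dotv sk (y - x1)
       + dotv (v + rho *: (A *m x1 - b)) (A *m (y - x1))
       + \sum_i vmax 0 (u + rho *: c x1) i 0 * (c y i 0 - c x1 i 0)
       + dotv (sigma *: (Q *m (x1 - xk))) (y - x1).
Proof.
move=> Cy; case: x1min => Cx1 x1le.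
have [w wE] : exists w, w = y - x1 by exists (y - x1).
rewrite -wE.
apply: (@ge0_of_linear_term _ _ (rho / 2 * dotv (A *m w) (A *m w)
  + \sum_i rho / 2 * (c y i 0 - c x1 i 0) ^+ 2 + sigma / 2 * dotv w (Q *m w))).
move=> t /andP[t0 t1]; have t01 : 0 <= t <= 1 by rewrite ltW.
have ytE : t *: y + (1 - t) *: x1 = x1 + t *: w.
  by apply/matrixP => i j; rewrite wE !mxE; ring.
have Cyt := convex_setP (@pC_convex _ _ _ _ P) t01 Cy Cx1; rewrite ytE in Cyt.
have gyt := convex_functionP (@pg_convex _ _ _ _ P) y x1 t01.
have cyt i := convex_functionP (@pc_convex _ _ _ _ P i) y x1 t01.
rewrite ytE in gyt; have {}cyt i : c (x1 + t *: w) i 0 <=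
    c x1 i 0 + t * (c y i 0 - c x1 i 0) by have := cyt i; rewrite ytE; lra.
have pen : \sum_i penalty rho (u i 0) (c (x1 + t *: w) i 0) <=
    \sum_i penalty rho (u i 0) (c x1 i 0)
    + t * (\sum_i vmax 0 (u + rho *: c x1) i 0 * (c y i 0 - c x1 i 0))
    + t ^+ 2 * (\sum_i rho / 2 * (c y i 0 - c x1 i 0) ^+ 2).
  rewrite !mulr_sumr -!big_split /=; apply: ler_sum => i _.
  apply: le_trans (penalty_incr _ rho0 (cyt i)) _.
  by rewrite le_eqVlt; apply/predU1l; rewrite !mxE; field.
have ellE : ell P (x1 + t *: w) = ell P x1 + t *: (A *m w).
  by rewrite /ell mulmxDr -scalemxAr addrAC.
have := x1le _ Cyt; rewrite !aug_LagrangianE !qnorm_sqr // ellE.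
have -> : x1 + t *: w - xk = (x1 - xk) + t *: w by rewrite addrAC.
rewrite -/(ell P x1); move: (ell P x1) (x1 - xk) {ellE} => L d.
rewrite (mulmxDr Q) -scalemxAr !dotvDr !dotvDl !dotvZl !dotvZr.
rewrite (dotvC (Q *m d) w) (dotv_sym d w Qsym) (dotvC (A *m w) L).
by move: gyt pen; lra.
Qed.

Lemma subproblem_descent : subdiff h xk sk -> C xk ->
  dc_Lagrangian rho x1 u v + sigma / 2 * dotv (x1 - xk) (Q *m (x1 - xk)) <=
  dc_Lagrangian rho xk u v.
Proof.
move=> hs Cxk; case: x1min => _ /(_ _ Cxk).
rewrite !aug_LagrangianE !qnorm_sqr // subrr dotv0r mulmx0 dotv0r mulr0.
by have := hs x1; rewrite /dc_Lagrangian; lra.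
Qed.

End OneStep.

(** The update of the multipliers after a step is a projection onto the residual
    of the equations and onto that of the violated inequalities, so it keeps the
    two pairings; and the penalties of the violated inequalities depend on [u]
    through their pairing only. *)
Lemma dc_Lagrangian_proj rho x (u u' : 'cV[R]_m) (v v' : 'cV[R]_p) :
  0 < rho -> (forall i, 0 <= u i 0) -> (forall i, 0 <= u' i 0) ->
  dotv v' (ell P x) = dotv v (ell P x) ->
  (forall i, c x i 0 <= 0 -> u' i 0 = u i 0) ->
  \sum_(i | 0 < c x i 0) u' i 0 * c x i 0 =
    \sum_(i | 0 < c x i 0) u i 0 * c x i 0 ->
  dc_Lagrangian rho x u' v' = dc_Lagrangian rho x u v.
Proof.
move=> rho0 u0 u'0 vE uE sumE; rewrite /dc_Lagrangian vE; congr (_ + _).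
rewrite (bigID (fun i => 0 < c x i 0)) [RHS](bigID (fun i => 0 < c x i 0)) /=.
congr (_ + _); last first.
  by apply: eq_bigr => i; rewrite -leNgt => /uE ->.
under eq_bigr => i /ltW ci do rewrite penalty_violated //.
under [RHS]eq_bigr => i /ltW ci do rewrite penalty_violated //.
by rewrite !big_split /= sumE.
Qed.

Lemma dc_Lagrangian_le_rho rho1 rho2 x (u : 'cV[R]_m) v :
  0 < rho1 -> rho1 <= rho2 -> (forall i, 0 <= u i 0) ->
  dc_Lagrangian rho2 x u v <= dc_Lagrangian rho1 x u v
    + (rho2 - rho1) * (dotv (ell P x) (ell P x)
       + \sum_i (c x i 0 ^+ 2 + (u i 0 / rho1) ^+ 2)).
Proof.
move=> r10 r12 u0.
have pen : \sum_i penalty rho2 (u i 0) (c x i 0) <=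
    \sum_i penalty rho1 (u i 0) (c x i 0)
    + (rho2 - rho1) * \sum_i (c x i 0 ^+ 2 + (u i 0 / rho1) ^+ 2).
  rewrite mulr_sumr -big_split; apply: ler_sum => i _; exact: penalty_le_rho.
have : 0 <= (rho2 - rho1) * dotv (ell P x) (ell P x).
  by rewrite mulr_ge0 ?dotv_ge0 // subr_ge0.
by move: pen; rewrite /dc_Lagrangian; lra.
Qed.

End Subproblem.

(** * Invariants of a run *)

Section Auxiliary.
Context {R : realType}.

Lemma dotv_bound n (x y : 'cV[R]_n) (a b : R) :
  (forall i, `|x i 0| <= a) -> (forall i, `|y i 0| <= b) ->
  `|dotv x y| <= n%:R * (a * b).
Proof.
move=> xa yb; rewrite dotvE; apply: le_trans (ler_norm_sum _ _ _) _.
rewrite mulr_natl -[n in leRHS]card_ord -sumr_const; apply: ler_sum => i _.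
by rewrite normrM ler_pM.
Qed.

Lemma powR_cvg_pinfty (I : Type) (F : set_system I) (FF : Filter F)
    (f : I -> R) (q : R) : 0 < q ->
  f k @[k --> F] --> +oo -> f k `^ q @[k --> F] --> +oo.
Proof.
move=> q0 /cvgryPge fy; apply/cvgryPge => A.
apply: filterS (fy (Num.max A 1 `^ q^-1)) => k fk.
have M0 : 0 <= Num.max A 1 by rewrite le_max ler01 orbT.
apply: (@le_trans _ _ (Num.max A 1)); first by rewrite le_max lexx.
have -> : Num.max A 1 = (Num.max A 1 `^ q^-1) `^ q.
  by rewrite -powRrM mulVf ?gt_eqF // powRr1.
apply: (ge0_ler_powR (ltW q0)) => //; rewrite nnegrE ?powR_ge0 //.
by apply: le_trans fk; apply: powR_ge0.
Qed.

Lemma powR_cvg_zero (I : Type) (F : set_system I) (FF : Filter F)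
    (f : I -> R) (q : R) : 0 < q -> (forall k, 0 <= f k) ->
  f k @[k --> F] --> 0 -> f k `^ q @[k --> F] --> 0.
Proof.
move=> q0 f0 /cvgrPdist_le fl; apply/cvgrPdist_le => e e0.
apply: filterS (fl (e `^ q^-1) (powR_gt0 _ e0)) => k.
rewrite !sub0r !normrN !ger0_norm ?powR_ge0 // => fk.
have -> : e = (e `^ q^-1) `^ q by rewrite -powRrM mulVf ?gt_eqF // powRr1 // ltW.
by apply: (ge0_ler_powR (ltW q0)) => //; rewrite nnegrE ?powR_ge0.
Qed.

Lemma cvg_sqr0 (I : Type) (F : set_system I) (FF : Filter F) (f : I -> R) :
  f k ^+ 2 @[k --> F] --> 0 -> f k @[k --> F] --> 0.
Proof.
move=> /cvgrPdist_le fl; apply/cvgrPdist_le => e e0.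
have e20 : 0 < e ^+ 2 by rewrite exprn_gt0.
apply: filterS (fl _ e20) => k; rewrite !sub0r !normrN.
by rewrite normrX ler_sqr ?nnegrE // ltW.
Qed.

Lemma cvg_inv_pinfty (I : Type) (F : set_system I) (FF : Filter F) (f : I -> R) :
  f k @[k --> F] --> +oo -> (f k)^-1 @[k --> F] --> 0.
Proof.
move=> /cvgryPge fy; apply/cvgrPdist_le => e e0.
have eV0 : 0 < e^-1 by rewrite invr_gt0.
apply: filterS (fy e^-1) => k fk; rewrite sub0r normrN.
have f0 : 0 < f k by apply: lt_le_trans fk.
by rewrite gtr0_norm ?invr_gt0 // -[e]invrK lef_pV2 ?posrE.
Qed.

Lemma cvg_contraction (f : nat -> R) (th : R) (k0 : nat) : 0 < th < 1 ->
  (forall k, 0 <= f k) ->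
  (forall k, (k0 <= k)%N -> f k.+1 <= th * f k) -> f k @[k --> \oo] --> 0.
Proof.
move=> /andP[th0 th1] f0 fth; rewrite -(cvg_shiftn k0).
have geo k : f (k + k0)%N <= f k0 * th ^+ k.
  elim: k => [|k IH]; first by rewrite add0n expr0 mulr1.
  rewrite addSn; apply: le_trans (fth _ (leq_addl _ _)) _.
  by rewrite exprS mulrCA ler_wpM2l // ltW.
apply: (@squeeze0 _ _ _ _ _ (fun k => f k0 * th ^+ k)).
  by apply: nearW => k; rewrite ger0_norm.
suff : f k0 * th ^+ k @[k --> \oo] --> f k0 * 0 by rewrite mulr0.
by apply: cvgM; [apply: cvg_cst|apply: cvg_expr; rewrite ger0_norm // ltW].
Qed.

Lemma bounded_funE (V : pseudoMetricNormedZmodType R) (f : nat -> V) :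
  bounded_fun f <-> exists B : R, forall k, `|f k| <= B.
Proof.
have pf : ProperFilter (globally [set: nat]) by apply: globally_properfilter 0 _.
split=> [hb|[B HB]].
  by have [B HB] := (@ex_bound _ _ _ f _ pf).1 hb; exists B => k; apply: HB.
by apply/(@ex_bound _ _ _ f _ pf); exists B => k _ /=.
Qed.

End Auxiliary.

Section Run.
Context {R : realType} {n m p : nat}.
Context (P : dcProblem R n m p) (a : psALMDC_param R n) (r : iterates R n m p).
Hypothesis hrun : psALMDC_generates P a r.
Local Notation g := (pg P).
Local Notation A := (pA P).
Local Notation c := (pc P).
Local Notation C := (pC P).
Local Notation Q := (a_Q a).
Local Notation x := (r_x r).
Local Notation s := (r_s r).
Local Notation sigma := (r_sigma r).
Local Notation rho := (r_rho r).
Local Notation u := (r_u r).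
Local Notation v := (r_v r).
Local Notation lam := (r_lam r).
Local Notation mu := (r_mu r).
Local Notation etabar := (a_etabar a).
Local Notation d := (step_length r).

Lemma step_length_ge0 k : 0 <= d k.
Proof. exact: enorm_ge0. Qed.

Lemma step_length_eq0 k : (d k == 0) = (x k.+1 == x k).
Proof. by rewrite /step_length enorm_eq0 subr_eq0. Qed.

Lemma sigma_gt0_incr k : 0 < sigma k /\ sigma k <= sigma k.+1.
Proof.
have h1 : 1 < etabar := a_etabar_gt1 a.
have incr j : 0 < sigma j -> sigma j <= sigma j.+1.
  move=> s0; have [_ [_ _ _ + _]] := (hrun.1, hrun.2 j).
  rewrite /step4; case: ifP => _; first by case=> ->.
  case=> + _ _ _ _; case: ifP => _ ->; first by rewrite ler_peMl // ltW.
  rewrite le_max; apply/orP; right; case: ifP => _; last by rewrite mul1r.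
  by rewrite ler_peMl // ltW.
suff s0 : 0 < sigma k by split; last exact: incr.
elim: k => [|k IH]; first by case: hrun => -[_ [] //].
exact: lt_le_trans IH (incr _ IH).
Qed.

Lemma sigma_gt0 k : 0 < sigma k.
Proof. by case: (sigma_gt0_incr k). Qed.

Lemma sigma_mono : {homo sigma : j k / (j <= k)%N >-> j <= k}.
Proof.
by apply: homo_leq => [//|y x' z|k]; [exact: le_trans|case: (sigma_gt0_incr k)].
Qed.

Lemma gamma_gt0 : 0 < a_gamma a.
Proof. by case/andP: (a_gamma01 a). Qed.

Lemma rhoE k : rho k = sigma k `^ a_gamma a.
Proof.
elim: k => [|k IH]; first by case: hrun => -[].
have [_ _ _ + _] := hrun.2 k; rewrite /step4; case: ifP => _; last by case.
by case=> -> ->.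
Qed.

Lemma rho_gt0 k : 0 < rho k.
Proof. by rewrite rhoE powR_gt0 // sigma_gt0. Qed.

Lemma rho_mono : {homo rho : j k / (j <= k)%N >-> j <= k}.
Proof.
move=> j k jk; rewrite !rhoE; apply: (ge0_ler_powR (ltW gamma_gt0)).
- by rewrite nnegrE ltW // sigma_gt0.
- by rewrite nnegrE ltW // sigma_gt0.
- exact: sigma_mono.
Qed.

Lemma rho0_le k : rho 0 <= rho k.
Proof. exact: rho_mono. Qed.

Lemma sigmaE k : sigma k = rho k `^ (a_gamma a)^-1.
Proof.
by rewrite rhoE -powRrM divff ?gt_eqF ?gamma_gt0 // powRr1 // ltW // sigma_gt0.
Qed.

Lemma bounded_sigma_rho :
  bounded_fun (sigma : nat -> R^o) <-> bounded_fun (rho : nat -> R^o).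
Proof.
split=> /bounded_funE[B HB]; apply/bounded_funE.
- exists (B `^ a_gamma a) => k; rewrite ger0_norm ?(ltW (rho_gt0 k)) // rhoE.
  have := HB k; rewrite ger0_norm ?(ltW (sigma_gt0 k)) // => sB.
  have s0 := ltW (sigma_gt0 k).
  by apply: (ge0_ler_powR (ltW gamma_gt0)); rewrite ?nnegrE // (le_trans s0).
- exists (B `^ (a_gamma a)^-1) => k; rewrite ger0_norm ?(ltW (sigma_gt0 k)) //.
  rewrite sigmaE; have := HB k; rewrite ger0_norm ?(ltW (rho_gt0 k)) // => sB.
  have s0 := ltW (rho_gt0 k); have g0 : 0 <= (a_gamma a)^-1.
    by rewrite invr_ge0 ltW // gamma_gt0.
  by apply: (ge0_ler_powR g0); rewrite ?nnegrE // (le_trans s0).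
Qed.

Lemma sigma_rho_pinfty :
  sigma k @[k --> \oo] --> +oo <-> rho k @[k --> \oo] --> +oo.
Proof.
split=> hy.
  by under eq_fun do rewrite rhoE; apply: powR_cvg_pinfty hy; apply: gamma_gt0.
under eq_fun do rewrite sigmaE; apply: powR_cvg_pinfty hy.
by rewrite invr_gt0 gamma_gt0.
Qed.

Lemma iterate_in_C k : C (x k.+1).
Proof. by have [[_ []]] := hrun.2 k. Qed.

Lemma Q_sym k : (Q k)^T = Q k.
Proof. by case: (a_Q_posdef a k). Qed.

Lemma Q_lo k y : a_lo a * dotv y y <= dotv y (Q k *m y).
Proof.
apply: le_trans (lambda_min_le _ (Q_sym k)).
by rewrite ler_wpM2r ?dotv_ge0 //; case: (a_Q_spectrum a k).
Qed.

Lemma Q_hi k y : dotv y (Q k *m y) <= a_hi a * dotv y y.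
Proof.
apply: le_trans (lambda_max_ge _ (Q_sym k)) _.
by rewrite ler_wpM2r ?dotv_ge0 //; case: (a_Q_spectrum a k) => _ [].
Qed.

Lemma Q_psd k y : 0 <= dotv y (Q k *m y).
Proof. by apply: le_trans (Q_lo k y); rewrite mulr_ge0 ?dotv_ge0 ?ltW ?a_lo_gt0. Qed.

Lemma Q_step_le k i : `|(Q k *m (x k.+1 - x k)) i 0| <= a_hi a * d k.
Proof. by apply: psd_coord_le (Q_sym k) _ _; [apply: Q_psd|apply: Q_hi]. Qed.

Lemma u_ge0 k i : 0 <= u k i 0.
Proof.
elim: k i => [|k IH] i; first by case: hrun => -[+ _ _ _] _; apply.
have [_ _ _ _ [_ ->]] := hrun.2 k; rewrite mxE; case: ifP => // /ltW ci.
rewrite mulr_ge0 // divr_ge0 // sumr_ge0 // => j cj.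
  by rewrite mulr_ge0 // ltW.
by rewrite sqr_ge0.
Qed.

Lemma v_proj k : dotv (v k.+1) (ell P (x k.+1)) = dotv (v k) (ell P (x k.+1)).
Proof.
have [_ _ _ _ [-> _]] := hrun.2 k; case: eqVneq => // neq.
rewrite dotvZl enorm_sqr divfK // dotv_eq0.
by rewrite /ell subr_eq0.
Qed.

Lemma u_proj k : let c1 := c (x k.+1) in
  \sum_(i | 0 < c1 i 0) u k.+1 i 0 * c1 i 0 =
  \sum_(i | 0 < c1 i 0) u k i 0 * c1 i 0.
Proof.
move=> c1; have [_ _ _ _ [_ ->]] := hrun.2 k; rewrite -/c1.
set uc := (X in _ = X); set cc := \sum_(j | _) c1 j 0 ^+ 2.
transitivity (uc / cc * cc).
  rewrite [RHS]mulr_sumr; apply: eq_bigr => i ci.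
  by rewrite mxE ci -mulrA expr2.
have [cc0|cc0] := eqVneq cc 0; last by rewrite divfK.
rewrite cc0 mulr0 /uc big1 // => i ci.
have := psumr_eq0P (P := fun i => 0 < c1 i 0) (F := fun i => c1 i 0 ^+ 2).
move=> /(_ _ cc0 i ci) /eqP; rewrite expf_eq0 /= => /(_ _) c0.
by rewrite (eqP (c0 _)) ?mulr0 // => j _; rewrite sqr_ge0.
Qed.

Lemma u_next_satisfied k i : c (x k.+1) i 0 <= 0 -> u k.+1 i 0 = u k i 0.
Proof. by move=> ci; have [_ _ _ _ [_ ->]] := hrun.2 k; rewrite mxE ltNge ci. Qed.

Lemma v_norm_le k : dotv (v k) (v k) <= dotv (v 0) (v 0).
Proof.
elim: k => // k; apply: le_trans; apply: dotv_proj_le.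
have := v_proj k; have [_ _ _ _ [-> _]] := hrun.2 k; case: eqVneq => [_ _|_].
  by rewrite subrr dotv0l.
by rewrite -/(ell P (x k.+1)) dotvZr dotvBl => ->; rewrite subrr mulr0.
Qed.

Lemma u_norm_le k : dotv (u k) (u k) <= dotv (u 0) (u 0).
Proof.
elim: k => // k; apply: le_trans; apply: dotv_proj_le.
have := u_proj k; rewrite /=; set c1 := c (x k.+1) => hu.
have [_ _ _ _ [_]] := hrun.2 k; rewrite -/c1; set t := _ / _ => uE.
transitivity (t * \sum_(i | 0 < c1 i 0) (u k i 0 * c1 i 0 - u k.+1 i 0 * c1 i 0)).
  rewrite dotvE (bigID (fun i => 0 < c1 i 0)) /= [X in _ + X]big1 => [|i ci].
    rewrite addr0 mulr_sumr; apply: eq_bigr => i ci.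
    by rewrite -mulrBl [RHS]mulrCA [in LHS]uE !mxE ci uE mxE ci.
  by rewrite uE !mxE (negbTE ci) subrr mul0r.
by rewrite sumrB hu subrr mulr0.
Qed.

Lemma u_bounded k i : `|u k i 0| <= enorm (u 0).
Proof.
apply: le_trans (coord_le_enorm _ _) _.
by rewrite -ler_sqr ?nnegrE ?enorm_ge0 // !enorm_sqr u_norm_le.
Qed.

Lemma v_bounded k j : `|v k j 0| <= enorm (v 0).
Proof.
apply: le_trans (coord_le_enorm _ _) _.
by rewrite -ler_sqr ?nnegrE ?enorm_ge0 // !enorm_sqr v_norm_le.
Qed.

Lemma lamE k i : lam k.+1 i 0 = Num.max 0 (u k i 0 + rho k * c (x k.+1) i 0).
Proof. by have [_ [_ ->] _ _ _] := hrun.2 k; rewrite !mxE. Qed.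

Lemma lam_ge0 k i : 0 <= lam k.+1 i 0.
Proof. by rewrite lamE le_max lexx. Qed.

Lemma muE k : mu k.+1 = v k + rho k *: ell P (x k.+1).
Proof. by have [_ [-> _] _ _ _] := hrun.2 k. Qed.

(** The first-order condition of the subproblem, in which the updated
    multipliers appear. *)
Lemma run_VI k y : C y ->
  0 <= g y - g (x k.+1) - dotv (s k) (y - x k.+1)
       + dotv (mu k.+1) (A *m (y - x k.+1))
       + \sum_i lam k.+1 i 0 * (c y i 0 - c (x k.+1) i 0)
       + dotv (sigma k *: (Q k *m (x k.+1 - x k))) (y - x k.+1).
Proof.
move=> Cy; have [[_ xmin] [-> ->] _ _ _] := hrun.2 k.
exact: subproblem_VI (rho_gt0 k) (Q_sym k) (Q_psd k) xmin _ Cy.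
Qed.

(** The update of [u] and [v] does not change the augmented Lagrangian, so the
    descent of each subproblem adds up along the run.  The subproblem is compared
    with its starting point, which lies in [C] from the index 1 on only. *)
Lemma run_descent k :
  dc_Lagrangian P (rho k.+1) (x k.+2) (u k.+2) (v k.+2)
    + sigma k.+1 * a_lo a / 2 * d k.+1 ^+ 2 <=
  dc_Lagrangian P (rho k.+1) (x k.+1) (u k.+1) (v k.+1).
Proof.
have [[hs xmin] _ _ _ _] := hrun.2 k.+1.
rewrite (@dc_Lagrangian_proj _ _ _ _ _ _ _ (u k.+1) _ (v k.+1)).
- have := subproblem_descent (Q_psd k.+1) xmin hs (iterate_in_C k).
  apply: le_trans; rewrite lerD2l enorm_sqr -!mulrA mulrCA [leRHS]mulrCA.
  have := Q_lo k.+1 (x k.+2 - x k.+1).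
  have : 0 <= sigma k.+1 / 2 by rewrite divr_ge0 // ltW // sigma_gt0.
  by move=> s0 /(ler_wpM2l s0); lra.
- exact: rho_gt0.
- exact: u_ge0.
- exact: u_ge0.
- exact: v_proj.
- by move=> i; apply: u_next_satisfied.
- exact: u_proj.
Qed.

End Run.

(** * Boundedness and vanishing steps *)

Lemma sumr_const_ord (R : realType) n (z : R) : \sum_(i < n) z = n%:R * z.
Proof. by rewrite sumr_const card_ord mulr_natl. Qed.

Lemma uniform_bound (R : realType) (I : finType) (T : Type) (f : I -> T -> R) :
  (forall i, exists B, forall t, `|f i t| <= B) ->
  exists2 B, 0 <= B & forall i t, `|f i t| <= B.
Proof.
move=> fB; have [B HB] := choice fB.
exists (\sum_i `|B i|) => [|i t]; first by rewrite sumr_ge0.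
apply: le_trans (HB i t) _; apply: le_trans (ler_norm _) _.
by rewrite (bigD1 i) //= lerDl sumr_ge0.
Qed.

Section BoundedRun.
Context {R : realType} {n m p : nat}.
Context (P : dcProblem R n m p) (a : psALMDC_param R n) (r : iterates R n m p).
Hypothesis hrun : psALMDC_generates P a r.
Hypothesis hbounded : bounded_fun (r_x r).
Local Notation g := (pg P).
Local Notation h := (ph P).
Local Notation c := (pc P).
Local Notation x := (r_x r).
Local Notation s := (r_s r).
Local Notation sigma := (r_sigma r).
Local Notation rho := (r_rho r).
Local Notation u := (r_u r).
Local Notation v := (r_v r).
Local Notation d := (step_length r).

Lemma x_bounded : exists B, forall k i, `|x k i 0| <= B.
Proof.
have /bounded_funE[B HB] := hbounded; exists B => k i.
apply: le_trans (HB k); rewrite /Num.norm /= mx_normrE.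
by apply: (le_bigmax _ (fun ij => `|x k ij.1 ij.2|) (i, 0)).
Qed.

Lemma convexf_run_bounded (f : 'cV[R]_n -> R) : convexf f ->
  exists B, forall k, `|f (x k)| <= B.
Proof.
move=> cf; have [B HB] := x_bounded; have [M HM] := convexf_bounded B cf.
by exists M => k; apply: HM.
Qed.

Lemma g_convexf : convexf g. Proof. exact: convex_functionP (@pg_convex _ _ _ _ P). Qed.
Lemma h_convexf : convexf h. Proof. exact: convex_functionP (@ph_convex _ _ _ _ P). Qed.
Lemma c_convexf i : convexf (fun y => c y i 0).
Proof. exact: convex_functionP (@pc_convex _ _ _ _ P i). Qed.

Lemma ell_affine t y z :
  ell P (t *: y + (1 - t) *: z) = t *: ell P y + (1 - t) *: ell P z.
Proof.
rewrite /ell mulmxDr -!scalemxAr.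
by apply/matrixP => i j; rewrite !mxE; ring.
Qed.

Lemma data_bounded : exists M, [/\ 0 <= M, forall k, `|g (x k)| <= M,
  forall k, `|h (x k)| <= M, forall i k, `|c (x k) i 0| <= M &
  forall j k, `|ell P (x k) j 0| <= M].
Proof.
have [Mg Hg] := convexf_run_bounded g_convexf.
have [Mh Hh] := convexf_run_bounded h_convexf.
have [Mc Mc0 Hc] := uniform_bound (fun i => convexf_run_bounded (c_convexf i)).
have cell j : convexf (fun y => ell P y j 0).
  by move=> t y z _; rewrite ell_affine !mxE.
have [Ml Ml0 Hl] := uniform_bound (fun j => convexf_run_bounded (cell j)).
exists (`|Mg| + `|Mh| + Mc + Ml); split=> [|k|k|i k|j k].
- by rewrite !addr_ge0.
- have := Hg k; have := ler_norm Mg; have := normr_ge0 Mh; lra.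
- have := Hh k; have := ler_norm Mh; have := normr_ge0 Mg; lra.
- have := Hc i k; have := normr_ge0 Mg; have := normr_ge0 Mh; lra.
- have := Hl j k; have := normr_ge0 Mg; have := normr_ge0 Mh; lra.
Qed.

Lemma s_bounded : exists B, forall k i, `|s k i 0| <= B.
Proof.
have [B HB] := x_bounded; have [M HM] := subdiff_bounded B h_convexf.
by exists M => k i; have [[hs _] _ _ _ _] := hrun.2 k; apply: HM hs i.
Qed.

(** The last estimate controls the effect of raising [rho] between two steps. *)
Lemma dc_Lagrangian_bounded : exists2 M, 0 <= M & forall k,
  [/\ - M <= dc_Lagrangian P (rho k) (x k) (u k) (v k),
      dc_Lagrangian P (rho k) (x k) (u k) (v k) <= M * (1 + rho k),
      - M <= dc_Lagrangian P (rho k) (x k.+1) (u k.+1) (v k.+1) &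
      dc_Lagrangian P (rho k.+1) (x k.+1) (u k.+1) (v k.+1) <=
        dc_Lagrangian P (rho k) (x k.+1) (u k.+1) (v k.+1)
        + (rho k.+1 - rho k) * M].
Proof.
have [M [M0 Hg Hh Hc Hl]] := data_bounded.
pose U := enorm (u 0); pose V := enorm (v 0); pose r0 := rho 0.
have r00 : 0 < r0 by apply: rho_gt0 hrun 0.
have U0 : 0 <= U by apply: enorm_ge0.
have V0 : 0 <= V by apply: enorm_ge0.
have rinv k : (rho k)^-1 <= r0^-1.
  by rewrite lef_pV2 ?posrE ?(rho_gt0 hrun) // (rho0_le hrun).
have uU k i : u k i 0 <= U.
  exact: le_trans (ler_norm _) (u_bounded hrun k i).
have usq k i : u k i 0 ^+ 2 <= U ^+ 2.
  by rewrite ler_sqr ?nnegrE ?(u_ge0 hrun).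
have csq k i : c (x k) i 0 ^+ 2 <= M ^+ 2.
  by rewrite -real_normK ?num_real // ler_sqr ?nnegrE.
have vl k k' : `|dotv (v k) (ell P (x k'))| <= p%:R * (V * M).
  by apply: dotv_bound => [i|i]; [apply: (v_bounded hrun)|apply: Hl].
have ll k : dotv (ell P (x k)) (ell P (x k)) <= p%:R * (M * M).
  apply: le_trans (ler_norm _) _.
  by apply: dotv_bound => [i|i]; apply: Hl.
have pen_ge k k' k'' : - (m%:R * (U ^+ 2 / (2 * r0))) <=
    \sum_i penalty (rho k) (u k' i 0) (c (x k'') i 0).
  rewrite -sumr_const_ord -sumrN.
  apply: ler_sum => i _; apply: le_trans (penalty_ge _ _ (rho_gt0 hrun k)).
  rewrite lerN2; apply: ler_pM; rewrite ?sqr_ge0 ?invr_ge0 ?mulr_ge0 //.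
  - by rewrite ltW // (rho_gt0 hrun).
  - by rewrite !invfM ler_wpM2l.
have pen_le k : \sum_i penalty (rho k) (u k i 0) (c (x k) i 0) <=
    m%:R * (U * M + rho k / 2 * M ^+ 2).
  rewrite -sumr_const_ord.
  apply: ler_sum => i _; have rk := rho_gt0 hrun k.
  have := @penalty_incr _ (rho k) (u k i 0) 0 (c (x k) i 0) M rk.
  rewrite add0r mulr0 addr0 => /(_ (le_trans (ler_norm _) (Hc i k))) pi.
  apply: le_trans pi _; have uk := u_ge0 hrun k i.
  rewrite {1}/penalty mulr0 addr0 (max_idPr uk) subrr mulr0 add0r.
  by rewrite lerD2r ler_wpM2r.
pose D := p%:R * (M * M) + m%:R * (M ^+ 2 + (U / r0) ^+ 2).
pose T1 := 2 * M + p%:R * (V * M) + m%:R * (U ^+ 2 / (2 * r0)).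
pose T2 := 2 * M + p%:R * (V * M) + m%:R * (U * M).
pose T3 := p%:R * (M * M) + m%:R * M ^+ 2.
have D0 : 0 <= D by rewrite addr_ge0 ?mulr_ge0 ?addr_ge0 ?sqr_ge0.
have T10 : 0 <= T1.
  rewrite !addr_ge0 ?mulr_ge0 ?sqr_ge0 ?invr_ge0 ?mulr_ge0 //; exact: ltW.
have T20 : 0 <= T2 by rewrite !addr_ge0 ?mulr_ge0.
have T30 : 0 <= T3 by rewrite !addr_ge0 ?mulr_ge0 ?sqr_ge0.
have lower k k' k'' : - T1 <= dc_Lagrangian P (rho k) (x k') (u k'') (v k'').
  have := pen_ge k k'' k'; have := vl k'' k'; have := Hg k'; have := Hh k'.
  rewrite !ler_norml => /andP[h1 h2] /andP[h3 h4] /andP[h5 h6] h7.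
  have : 0 <= rho k / 2 * dotv (ell P (x k')) (ell P (x k')).
    by rewrite mulr_ge0 ?dotv_ge0 // divr_ge0 // ltW // (rho_gt0 hrun).
  rewrite /T1 /dc_Lagrangian; lra.
exists (T1 + T2 + T3 + D) => [|k]; first by move: D0 T10 T20 T30; lra.
split.
- by have := lower k k k; lra.
- have := pen_le k; have := vl k k; have := Hg k; have := Hh k.
  rewrite !ler_norml => /andP[h1 h2] /andP[h3 h4] /andP[h5 h6] h7.
  have rk := ltW (rho_gt0 hrun k).
  have : rho k * dotv (ell P (x k)) (ell P (x k)) <= rho k * (p%:R * (M * M)).
    exact: ler_wpM2l.
  have : 0 <= rho k * (p%:R * (M * M)) by rewrite !mulr_ge0.
  have : 0 <= rho k * (m%:R * M ^+ 2) by rewrite !mulr_ge0 ?sqr_ge0.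
  have : 0 <= rho k * (T1 + T2 + D) by rewrite mulr_ge0 //; move: D0 T10 T20; lra.
  rewrite /dc_Lagrangian; move: h7 T10 D0 T30; rewrite /T2 /T3.
  by move: (T1) (D) => T D' *; lra.
- by have := lower k k.+1 k.+1; lra.
- have rr := rho_mono hrun (leqnSn k).
  apply: le_trans (dc_Lagrangian_le_rho _ _ _ (rho_gt0 hrun k) rr _) _.
    exact: (u_ge0 hrun).
  rewrite lerD2l ler_wpM2l ?subr_ge0 //.
  apply: (@le_trans _ _ D); last by lra.
  apply: lerD => //; rewrite -sumr_const_ord.
  apply: ler_sum => i _; apply: lerD; first exact: csq.
  have uk := u_ge0 hrun k.+1 i; have rk := ltW (rho_gt0 hrun k).
  rewrite ler_sqr ?nnegrE ?divr_ge0 ?(ltW r00) //.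
  by apply: ler_pM => //; rewrite invr_ge0.
Qed.

Lemma step_cvg0 (w : nat -> R) : w k @[k --> \oo] --> 0 ->
  (forall k, d k.+1 ^+ 2 <= w k) -> d k @[k --> \oo] --> 0.
Proof.
move=> w0 dw; rewrite -(cvg_shiftS d); apply: cvg_sqr0.
apply: (@squeeze0 _ _ _ _ _ w) => //.
by apply: nearW => k; rewrite ger0_norm ?sqr_ge0.
Qed.

(** With [M] large the sequence [dc_Lagrangian - M * rho] is nonincreasing, and
    it is bounded below; each step lowers it by a multiple of the squared step
    length. *)
Lemma step_cvg0_bounded : bounded_fun (sigma : nat -> R^o) ->
  d k @[k --> \oo] --> 0.
Proof.
move=> /(bounded_sigma_rho hrun) /bounded_funE[S HS].
have [M M0 HM] := dc_Lagrangian_bounded.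
pose e k := dc_Lagrangian P (rho k.+1) (x k.+1) (u k.+1) (v k.+1) - rho k.+1 * M.
pose q := sigma 0 * a_lo a / 2.
have q0 : 0 < q by rewrite divr_gt0 // mulr_gt0 ?(sigma_gt0 hrun) // a_lo_gt0.
have dec k : e k.+1 + q * d k.+1 ^+ 2 <= e k.
  have [_ _ _ hr] := HM k.+1; have hd := run_descent hrun k.
  have : q * d k.+1 ^+ 2 <= sigma k.+1 * a_lo a / 2 * d k.+1 ^+ 2.
    rewrite ler_wpM2r ?sqr_ge0 // ler_pM2r ?invr_gt0 // ler_pM2r ?a_lo_gt0 //.
    exact: (sigma_mono hrun).
  by rewrite /e; lra.
have dec' k : e k.+1 <= e k.
  by apply: le_trans (dec k); rewrite lerDl mulr_ge0 ?sqr_ge0 // ltW.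
have ecvg : cvgn e.
  apply: nonincreasing_is_cvgn.
    exact/nonincreasing_seqP.
  exists (- M - S * M) => _ [k _ <-]; have [hk _ _ _] := HM k.+1.
  rewrite lerB //; apply: ler_wpM2r => //.
  exact: le_trans (ler_norm _) (HS _).
apply: (@step_cvg0 (fun k => q^-1 * (e k - e k.+1))) => [|k].
  suff : q^-1 * (e k - e k.+1) @[k --> \oo] --> q^-1 * (limn e - limn e).
    by rewrite subrr mulr0.
  apply: cvgM; first exact: cvg_cst.
  by apply: cvgB => //; rewrite (cvg_shiftS e).
by rewrite ler_pdivlMl //; have := dec k; lra.
Qed.

(** The augmented Lagrangian is of order [rho = sigma `^ gamma] with [gamma < 1],
    while a step lowers it by a multiple of [sigma] times its squared length. *)
Lemma step_cvg0_pinfty : sigma k @[k --> \oo] --> +oo -> d k @[k --> \oo] --> 0.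
Proof.
move=> sy; have [M M0 HM] := dc_Lagrangian_bounded.
have lo0 := a_lo_gt0 a; have [g0 g1] := andP (a_gamma01 a).
apply: (@step_cvg0 (fun k => 2 / a_lo a * (2 * M) * (sigma k.+1)^-1
   + 2 / a_lo a * M * (sigma k.+1 `^ (1 - a_gamma a))^-1)) => [|k].
  suff : 2 / a_lo a * (2 * M) * (sigma k.+1)^-1
   + 2 / a_lo a * M * (sigma k.+1 `^ (1 - a_gamma a))^-1 @[k --> \oo]
     --> 2 / a_lo a * (2 * M) * 0 + 2 / a_lo a * M * 0.
    by rewrite !mulr0 addr0.
  have sy' : sigma k.+1 @[k --> \oo] --> +oo by rewrite (cvg_shiftS sigma).
  apply: cvgD; (apply: cvgM; first exact: cvg_cst); apply: cvg_inv_pinfty => //.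
  by apply: powR_cvg_pinfty => //; rewrite subr_gt0.
have s0 := sigma_gt0 hrun k.+1.
have -> : (sigma k.+1 `^ (1 - a_gamma a))^-1 = rho k.+1 / sigma k.+1.
  rewrite powRB ?gt_eqF ?implybT // powRr1 ?(ltW s0) // invfM invrK mulrC.
  by rewrite (rhoE hrun).
have [_ hub _ _] := HM k.+1; have [_ _ hlb _] := HM k.+1.
have hd := run_descent hrun k.
have -> : 2 / a_lo a * (2 * M) / sigma k.+1
   + 2 / a_lo a * M * (rho k.+1 / sigma k.+1)
   = (2 * M + M * rho k.+1) / (sigma k.+1 * a_lo a / 2).
  by field; rewrite !gt_eqF.
rewrite ler_pdivlMr ?divr_gt0 ?mulr_gt0 //; move: hub hlb hd; lra.
Qed.

End BoundedRun.

(** * Limits of the optimality conditions *)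

Lemma infinite_set_natP (J : set nat) :
  (forall N, exists2 k, (N <= k)%N & J k) -> infinite_set J.
Proof.
move=> hJ /finite_seqP[s Js].
have [k sk Jk] := hJ (\max_(i <- s) i).+1.
have /= ks : k \in s by move: Jk; rewrite Js.
by move: sk; rewrite ltnNge; apply/negP/negPn; apply: leq_bigmax_seq.
Qed.

(** Choosing one index in each member of a filter finer than the cofinite one
    produces an index set along which the convergence persists; an index beyond
    the first [N] chosen ones is chosen for the precision [N] at least. *)
Lemma infinite_set_cvg0 (R : realType) (F : set_system nat) (FF : ProperFilter F)
    (e : nat -> R) : \oo `<=` F -> e k @[k --> F] --> 0 ->
  exists J, infinite_set J /\ e k @[k --> within J \oo] --> 0.
Proof.
move=> nF /cvgrPdist_le e0.
have pick N : exists k, (N <= k)%N /\ `|e k| <= N.+1%:R^-1.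
  have FN : F [set k | (N <= k)%N] by apply: nF; exists N.
  have := e0 N.+1%:R^-1; rewrite invr_gt0 ltr0n => /(_ isT).
  move=> /(filterI FN) /filter_ex[k [/= Nk ek]].
  by exists k; split=> //; rewrite sub0r normrN in ek.
have [phi /all_and2 [phi_ge phi_e]] := choice pick.
exists (range phi); split.
  by apply: infinite_set_natP => N; exists (phi N).
apply/cvgrPdist_le => eps eps0.
have [N _ HN] := near_infty_natSinv_lt (PosNum eps0).
exists (\max_(i < N) phi i).+1 => // k /= Nk [i _ ik]; rewrite sub0r normrN -ik.
apply: le_trans (phi_e i) _; apply/ltW; apply: HN; rewrite /= leqNgt.
apply/negP => iN; move: Nk; rewrite ltnNge => /negP; apply; rewrite -ik.
exact: (leq_bigmax (Ordinal iN)).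
Qed.

Lemma within_proper (J : set nat) :
  (forall N, exists2 k, (N <= k)%N & J k) -> ProperFilter (within J \oo).
Proof.
move=> hJ; apply: Build_ProperFilter => -[N _ HN].
by have [k Nk Jk] := hJ N; apply: (HN k Nk Jk).
Qed.

(** A cluster point of a sequence is its limit along some ultrafilter. *)
Lemma cluster_ultra (R : realType) (V : pseudoMetricNormedZmodType R)
    (x : nat -> V) (l : V) : cluster (x k @[k --> \oo]) l ->
  exists U : set_system nat,
    [/\ UltraFilter U, \oo `<=` U & x k @[k --> U] --> l].
Proof.
move=> xl; pose F : set_system nat := fun S => exists N e, 0 < e /\
  forall k, (N <= k)%N -> `|l - x k| <= e -> S k.
have PF : ProperFilter F.
  apply: Build_ProperFilter.
    move=> [N [e [e0 HS]]].
    have [||y [[k Nk <-] ky]] := xl (x @` [set k | (N <= k)%N]) [set y | `|l - y| <= e].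
    - by exists N => // k Nk; exists k.
    - by apply/nbhs_ballP; exists e => // y; rewrite -ball_normE /= => /ltW.
    exact: HS Nk ky.
  split.
  - by exists 0%N, 1.
  - move=> S T [N [e [e0 HS]]] [N' [e' [e'0 HT]]].
    exists (maxn N N'), (Num.min e e'); split; first by rewrite lt_min e0.
    move=> k; rewrite geq_max le_min => /andP[Nk N'k] /andP[ke ke'].
    by split; [apply: HS|apply: HT].
  - move=> S T ST [N [e [e0 HS]]]; exists N, e; split=> // k Nk ke.
    by apply: ST; apply: HS.
have [U [UU FU]] := ultraFilterLemma PF.
exists U; split=> //.
- by move=> S [N _ HN]; apply: FU; exists N, 1; split=> // k Nk _; apply: HN.
- apply/cvgrPdist_le => e e0; apply: FU; exists 0%N, e; split=> //.
Qed.

Section LimitPoint.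
Context {R : realType} {n m p : nat}.
Context (P : dcProblem R n m p) (a : psALMDC_param R n) (r : iterates R n m p).
Hypothesis hrun : psALMDC_generates P a r.
Hypothesis hbounded : bounded_fun (r_x r).
Local Notation g := (pg P).
Local Notation h := (ph P).
Local Notation A := (pA P).
Local Notation c := (pc P).
Local Notation C := (pC P).
Local Notation Q := (a_Q a).
Local Notation x := (r_x r).
Local Notation s := (r_s r).
Local Notation sigma := (r_sigma r).
Local Notation lam := (r_lam r).
Local Notation mu := (r_mu r).
Local Notation d := (step_length r).

(** Stationarity as a variational inequality says that [xs] minimises a sum of
    finite convex functions over [C], to which the sum rule applies. *)
Lemma KKT_of_VI xs ss (ls : 'cV[R]_m) (ms : 'cV[R]_p) :
  feasible P xs -> subdiff h xs ss ->
  (forall i, 0 <= ls i 0) -> (forall i, ls i 0 * c xs i 0 = 0) ->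
  (forall y, C y -> 0 <= g y - g xs - dotv ss (y - xs) + dotv ms (A *m (y - xs))
    + \sum_i ls i 0 * (c y i 0 - c xs i 0)) ->
  generalized_KKT P xs ls ms.
Proof.
move=> [Axs cxs Cxs] hss ls0 lsc VI.
pose G y := g y - dotv ss y + dotv ms (A *m y).
pose F (j : 'I_m.+1) : 'cV[R]_n -> R :=
  if unlift ord0 j is Some i then fun y => ls i 0 * c y i 0 else G.
have F0 : F ord0 = G by rewrite /F unlift_none.
have Fl i : F (lift ord0 i) = fun y => ls i 0 * c y i 0 by rewrite /F liftK.
have cF j : convexf (F j).
  rewrite /F; case: (unlift ord0 j) => [i|].
    by apply: convexf_scale => //; apply: c_convexf.
  move=> t y z t01; have := g_convexf P y z t01.
  rewrite /G mulmxDr -!scalemxAr !dotvDr !dotvZr; lra.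
have [|S [HS Sn]] := subdiff_sum_rule cF (convex_setP (@pC_convex _ _ _ _ P)) Cxs.
  move=> y Cy; rewrite !big_ord_recl F0.
  under eq_bigr do rewrite Fl; under [X in _ <= _ + X]eq_bigr do rewrite Fl.
  have sE : \sum_i ls i 0 * (c y i 0 - c xs i 0) =
      \sum_i ls i 0 * c y i 0 - \sum_i ls i 0 * c xs i 0.
    by rewrite -sumrB; apply: eq_bigr => i _; rewrite mulrBr.
  have := VI y Cy; rewrite sE /G mulmxBr !dotvBr; lra.
have sub i : exists sc, subdiff (fun y => c y i 0) xs sc /\
    S (lift ord0 i) = ls i 0 *: sc.
  have := HS (lift ord0 i); rewrite Fl => hS.
  by have [sc ? ?] := subdiff_scale (c_convexf P i) (ls0 i) hS; exists sc.
have [sc /all_and2 [Hsc scE]] := choice sub.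
split=> //; first exists ss, (S ord0 + ss - A^T *m ms), sc, (- \sum_j S j).
  split=> //.
- move=> y; have := HS ord0 y; rewrite F0 /G dotvBl dotvDl.
  rewrite -dotv_mulmx_tr mulmxBr !dotvBr; lra.
- rewrite big_ord_recl (eq_bigr _ (fun i _ => scE i)) subrK.
  by rewrite opprD addrA addrAC addrK addrC addKr.
Qed.

Section AlongUltrafilter.
Variables (U : set_system nat) (xs : 'cV[R]_n).
Context {UU : UltraFilter U}.
Hypothesis nU : \oo `<=` U.
Hypothesis xU : x k @[k --> U] --> xs.
Hypothesis dU : d k @[k --> U] --> 0.
Hypothesis sdU : sigma k * d k @[k --> U] --> 0.

Let PU : ProperFilter U. Proof. exact: ultra_proper. Qed.

Lemma next_cvg : x k.+1 @[k --> U] --> xs.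
Proof.
apply/cvg_colP => i; move/cvg_colP: xU => /(_ i) xi.
have di : (x k.+1 - x k) i 0 @[k --> U] --> 0.
  by apply: squeeze0 dU; apply: nearW => k; apply: coord_le_enorm.
have -> : (fun k => x k.+1 i 0) = (fun k => (x k.+1 - x k) i 0 + x k i 0).
  by apply/funext => k; rewrite !mxE subrK.
by rewrite -[X in _ --> X]add0r; apply: cvgD.
Qed.

Lemma proximal_term_cvg0 :
  sigma k *: (Q k *m (x k.+1 - x k)) @[k --> U] --> (0 : 'cV[R]_n).
Proof.
apply/cvg_colP => i; rewrite mxE.
apply: (@squeeze0 _ _ _ _ _ (fun k => a_hi a * (sigma k * d k))).
  apply: nearW => k; have s0 := sigma_gt0 hrun k.
  rewrite mxE normrM (gtr0_norm s0) mulrCA ler_pM2l //; exact: Q_step_le.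
suff : a_hi a * (sigma k * d k) @[k --> U] --> a_hi a * 0 by rewrite mulr0.
by apply: cvgM => //; apply: cvg_cst.
Qed.

Lemma limit_in_C : C xs.
Proof.
apply: closed_cvg next_cvg; first exact: pC_closed.
by apply: nearW => k; apply: (iterate_in_C hrun).
Qed.

Lemma limit_cluster : cluster (x k @[k --> \oo]) xs.
Proof.
move=> S T xS xsT; have US : U (x @^-1` S) by apply: nU.
have UT : U (x @^-1` T) by apply: xU.
have UST : U (x @^-1` S `&` x @^-1` T) by apply: filterI.
by have /filter_ex[k [Sk Tk]] := UST; exists (x k).
Qed.

(** Passing to the limit in the optimality conditions of the subproblems. *)
Lemma KKT_of_limit :
  (forall i, exists B : R, \forall k \near U, `|lam k.+1 i 0| <= B) ->
  (forall j, exists B : R, \forall k \near U, `|mu k.+1 j 0| <= B) ->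
  feasible P xs ->
  (forall i, lam k.+1 i 0 * c (x k.+1) i 0 @[k --> U] --> 0) ->
  exists ls ms, generalized_KKT P xs ls ms /\
    exists J : set nat, infinite_set J /\ converges_along r J xs ls ms.
Proof.
move=> lamB muB feas compl.
have [ls lsU] := ultra_cvg_bounded_col lamB.
have [ms msU] := ultra_cvg_bounded_col muB.
have [|ss ssU] := @ultra_cvg_bounded_col _ _ U UU _ s.
  have [B HB] := s_bounded hrun hbounded.
  by move=> i; exists B; apply: nearW => k; apply: HB.
have x1U := next_cvg.
have cU i : c (x k.+1) i 0 @[k --> U] --> c xs i 0.
  exact: (cvg_convexf (c_convexf P i) x1U).
have lU i : lam k.+1 i 0 @[k --> U] --> ls i 0 by move/cvg_colP: lsU; apply.
exists ls, ms; split.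
  apply: (KKT_of_VI (ss := ss)) => //.
  - move=> y; have hU : h (x k) @[k --> U] --> h xs.
      exact: cvg_convexf (h_convexf P) xU.
    have yU : y - x k @[k --> U] --> y - xs.
      by apply: cvgB => //; apply: cvg_cst.
    have hl : h (x k) + dotv (s k) (y - x k) @[k --> U] -->
        h xs + dotv ss (y - xs) by apply: cvgD => //; apply: cvg_dotv.
    apply: (cvgr_to_le hl).
    by apply: nearW => k; have [[hs _] _ _ _ _] := hrun.2 k; apply: hs.
  - move=> i; apply: (cvgr_to_ge (lU i)).
    by apply: nearW => k; apply: (lam_ge0 hrun).
  - move=> i; have lc : lam k.+1 i 0 * c (x k.+1) i 0 @[k --> U] --> ls i 0 * c xs i 0.
      by apply: cvgM.
    exact: (cvg_unique (@norm_hausdorff R R^o) lc (compl i)).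
  - move=> y Cy; rewrite -[leRHS]addr0 -[X in _ <= _ + X](dotv0l (y - xs)).
    have yU : y - x k.+1 @[k --> U] --> y - xs.
      by apply: cvgB => //; apply: cvg_cst.
    suff hl : g y - g (x k.+1) - dotv (s k) (y - x k.+1)
        + dotv (mu k.+1) (A *m (y - x k.+1))
        + \sum_i lam k.+1 i 0 * (c y i 0 - c (x k.+1) i 0)
        + dotv (sigma k *: (Q k *m (x k.+1 - x k))) (y - x k.+1) @[k --> U] -->
        g y - g xs - dotv ss (y - xs) + dotv ms (A *m (y - xs))
        + \sum_i ls i 0 * (c y i 0 - c xs i 0) + dotv 0 (y - xs).
      by apply: (cvgr_to_ge hl); apply: nearW => k; apply: (run_VI hrun).
    apply: cvgD; last by apply: cvg_dotv => //; apply: proximal_term_cvg0.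
    apply: cvgD; last first.
      apply: cvg_sumr => i; apply: cvgM => //.
      by apply: cvgB => //; apply: cvg_cst.
    apply: cvgD; last by apply: cvg_dotv => //; apply: cvg_mulmx.
    apply: cvgB; last exact: cvg_dotv.
    apply: cvgB; first exact: cvg_cst.
    exact: cvg_convexf (g_convexf P) x1U.
pose e k := `|xs - x k| + `|ls - lam k| + `|ms - mu k|.
have eU : e k @[k --> (k.+1 @[k --> U])] --> 0.
  suff : e k.+1 @[k --> U] --> `|xs - xs| + `|ls - ls| + `|ms - ms|.
    by rewrite !subrr !normr0 !addr0.
  apply: cvgD; first apply: cvgD; apply: cvg_norm; apply: cvgB => //;
  exact: cvg_cst.
have nU1 : \oo `<=` k.+1 @[k --> U].
  by move=> S [N _ HN]; apply: nU; exists N => // k /= Nk; apply: HN => /=; apply: leqW.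
have [J [Jinf /cvgrPdist_le eJ]] := infinite_set_cvg0 _ nU1 eU.
exists J; split=> //; split; apply/cvgrPdist_le => z z0;
  apply: filterS (eJ z z0) => k; rewrite sub0r normrN => /(le_trans (ler_norm _));
  apply: le_trans; rewrite /e.
- by rewrite -addrA lerDl addr_ge0.
- by rewrite addrAC lerDr addr_ge0.
- by rewrite lerDr addr_ge0.
Qed.

End AlongUltrafilter.
End LimitPoint.

(** * The two cases *)

Section Cases.
Context {R : realType} {n m p : nat}.
Context (P : dcProblem R n m p) (a : psALMDC_param R n) (r : iterates R n m p).
Hypothesis hrun : psALMDC_generates P a r.
Hypothesis hbounded : bounded_fun (r_x r).
Local Notation g := (pg P).
Local Notation h := (ph P).
Local Notation A := (pA P).
Local Notation c := (pc P).
Local Notation C := (pC P).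
Local Notation Q := (a_Q a).
Local Notation x := (r_x r).
Local Notation sigma := (r_sigma r).
Local Notation rho := (r_rho r).
Local Notation eps := (r_eps r).
Local Notation u := (r_u r).
Local Notation v := (r_v r).
Local Notation lam := (r_lam r).
Local Notation mu := (r_mu r).
Local Notation I1 := (r_I1 r).
Local Notation alpha := (a_alpha a).
Local Notation etabar := (a_etabar a).
Local Notation d := (step_length r).

Lemma alpha_gt0 : 0 < alpha. Proof. by case/andP: (a_alpha01 a). Qed.

Section BoundedPenalty.
Hypothesis sigma_bounded : bounded_fun (sigma : nat -> R^o).

(** A change of the penalty parameter either multiplies [sigma] by [etabar],
    possible finitely often only, or makes it at least [d k `^ (- alpha)], which
    is unbounded as the steps vanish. *)
Lemma progress_eventually :
  exists k0, forall k, (k0 <= k)%N -> sufficient_progress P a r k.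
Proof.
have /bounded_funE[S HS] := sigma_bounded.
have sS k : sigma k <= S by apply: le_trans (HS k); apply: ler_norm.
have S0 : 0 < S by apply: lt_le_trans (sS 0); apply: sigma_gt0 hrun 0.
have dal : d k `^ alpha @[k --> \oo] --> 0.
  apply: powR_cvg_zero alpha_gt0 (step_length_ge0 r) _.
  exact: step_cvg0_bounded hrun hbounded sigma_bounded.
have SV0 : 0 < (S + S)^-1 by rewrite invr_gt0 addr_gt0.
have [N1 _ H1] := (cvgrPdist_le _ _).1 dal _ SV0.
have scvg : cvgn sigma.
  apply: nondecreasing_is_cvgn; first exact: (sigma_mono hrun).
  by exists S => _ [k _ <-].
have q0 : 0 < (etabar - 1) * sigma 0 / 2.
  by rewrite divr_gt0 // mulr_gt0 ?subr_gt0 ?a_etabar_gt1 // (sigma_gt0 hrun).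
have sdiff : sigma k.+1 - sigma k @[k --> \oo] --> 0.
  suff : sigma k.+1 - sigma k @[k --> \oo] --> limn sigma - limn sigma.
    by rewrite subrr.
  by apply: cvgB => //; rewrite (cvg_shiftS sigma).
have [N2 _ H2] := (cvgrPdist_le _ _).1 sdiff _ q0.
exists (maxn N1 N2) => k; rewrite geq_max => /andP[k1 k2].
have [_ _ _ + _] := hrun.2 k; rewrite /step4; case: ifP => // _ [+ _ _ _ _].
have s0 := sigma_gt0 hrun k.
case: eqVneq => [xx sE|xx sE].
  have := H2 k k2; rewrite /= sub0r normrN sE => /(le_trans (ler_norm _)).
  have := sigma_mono hrun (leq0n k); have e1 := a_etabar_gt1 a.
  have : (etabar - 1) * sigma 0 <= (etabar - 1) * sigma k.
    by rewrite ler_wpM2l ?subr_ge0 ?(ltW e1) // (sigma_mono hrun).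
  by move: q0; lra.
have := sS k.+1; rewrite sE ge_max => /andP[dS _].
have d0 : 0 < d k by rewrite lt_def step_length_eq0 xx step_length_ge0.
have da0 : 0 < d k `^ alpha by rewrite powR_gt0.
have := H1 k k1; rewrite /= sub0r normrN gtr0_norm // => /(le_trans _) h2.
move: dS; rewrite powRN => dS.
have : S^-1 <= d k `^ alpha by rewrite -[leRHS]invrK lef_pV2 ?posrE // invr_gt0.
move=> /h2; rewrite lef_pV2 ?posrE ?addr_gt0 //; lra.
Qed.

Lemma residual_cvg0 : enorm (ell P (x k)) @[k --> \oo] --> 0.
Proof.
have [k0 hk] := progress_eventually.
apply: (@cvg_contraction _ _ (a_theta a) k0); first exact: a_theta01.
  by move=> k; apply: enorm_ge0.
by move=> k /hk /andP[].
Qed.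

Lemma compl_residual_cvg0 : compl_residual P r k @[k --> \oo] --> 0.
Proof.
have [k0 hk] := progress_eventually.
apply: (@cvg_contraction _ _ (a_theta a) k0); first exact: a_theta01.
  by move=> k; apply: enorm_ge0.
by move=> k k0k; have /andP[] := hk k.+1 (leqW k0k).
Qed.

Lemma c_le_compl_residual k i : c (x k.+1) i 0 <= compl_residual P r k.
Proof.
have := coord_le_enorm (vmin (- c (x k.+1)) ((rho k)^-1 *: u k)) i.
rewrite -/(compl_residual P r k); apply: le_trans; rewrite !mxE.
rewrite -[X in X <= _]opprK -normrN; apply: le_trans (ler_norm _).
by rewrite lerN2 ge_min lexx.
Qed.

(** Where the minimum of [- c] and [u / rho] is [- c], the residual bounds [c]
    itself; elsewhere [u + rho * c] is negative and the multiplier vanishes. *)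
Lemma lam_c_le k i :
  `|lam k.+1 i 0 * c (x k.+1) i 0| <= lam k.+1 i 0 * compl_residual P r k.
Proof.
have l0 := lam_ge0 hrun k i; rewrite normrM ger0_norm //.
have rk := rho_gt0 hrun k.
have [h|h] := leP (- c (x k.+1) i 0) ((rho k)^-1 * u k i 0).
  rewrite ler_wpM2l //.
  have := coord_le_enorm (vmin (- c (x k.+1)) ((rho k)^-1 *: u k)) i.
  by rewrite !mxE (min_idPl h) normrN.
suff -> : lam k.+1 i 0 = 0 by rewrite !mul0r.
rewrite (lamE hrun); apply/max_idPl.
move: h; rewrite mulrC ltr_pdivrMr //; lra.
Qed.

(** As [sigma] is bounded, the proximal term vanishes with the steps; both
    residuals contract geometrically from some index on, which makes the limit
    feasible and complementary. *)
Lemma bounded_case xs : cluster (x k @[k --> \oo]) xs ->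
  exists ls ms, generalized_KKT P xs ls ms /\
    exists J : set nat, infinite_set J /\ converges_along r J xs ls ms.
Proof.
move=> /cluster_ultra[U [UU nU xU]].
have dU : d k @[k --> U] --> 0.
  exact: cvg_finer nU (step_cvg0_bounded hrun hbounded sigma_bounded).
have /bounded_funE[S HS] := sigma_bounded.
have /(bounded_sigma_rho hrun)/bounded_funE[S' HS'] := sigma_bounded.
have rS k : rho k <= S' by apply: le_trans (HS' k); apply: ler_norm.
have sdU : sigma k * d k @[k --> U] --> 0.
  by apply: (@cvg0_mul_bounded _ _ _ _ _ _ S) => //; apply: nearW.
have [M [M0 _ _ Hc Hl]] := data_bounded P hbounded.
have lamB i k : `|lam k.+1 i 0| <= enorm (u 0) + S' * M.
  rewrite ger0_norm ?(lam_ge0 hrun) // (lamE hrun).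
  have rk := ltW (rho_gt0 hrun k); have rS0 := le_trans rk (rS k).
  rewrite ge_max addr_ge0 ?enorm_ge0 ?mulr_ge0 //=; apply: lerD.
    exact: le_trans (ler_norm _) (u_bounded hrun k i).
  apply: le_trans (ler_norm _) _; rewrite normrM ger0_norm //.
  by apply: ler_pM.
have ellU j : ell P (x k) j 0 @[k --> U] --> 0.
  apply: (squeeze0 _ (cvg_finer nU residual_cvg0)).
  by apply: nearW => k; apply: coord_le_enorm.
have x1U : x k.+1 @[k --> U] --> xs by apply: next_cvg xU dU.
have cU i : c (x k.+1) i 0 @[k --> U] --> c xs i 0.
  exact: (cvg_convexf (c_convexf P i) x1U).
have rU : compl_residual P r k @[k --> U] --> 0.
  exact: cvg_finer nU compl_residual_cvg0.
apply: (KKT_of_limit hrun hbounded nU xU dU sdU).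
- by move=> i; exists (enorm (u 0) + S' * M); apply: nearW.
- move=> j; exists (enorm (v 0) + S' * M); apply: nearW => k.
  rewrite (muE hrun) !mxE; apply: le_trans (ler_normD _ _) _; apply: lerD.
    exact: (v_bounded hrun).
  have rk := ltW (rho_gt0 hrun k); rewrite normrM ger0_norm //; apply: ler_pM => //.
  by have := Hl j k.+1; rewrite !mxE.
- split=> [|i|]; last exact: (limit_in_C hrun xU dU).
    apply/eqP; rewrite -subr_eq0; apply/eqP/matrixP => j l; rewrite (ord1 l) [RHS]mxE.
    have lU : ell P (x k) @[k --> U] --> ell P xs.
      by apply: cvgB; [apply: cvg_mulmx|apply: cvg_cst].
    have lUj : ell P (x k) j 0 @[k --> U] --> ell P xs j 0.
      by move/cvg_colP: lU; apply.
    exact: (cvg_unique (@norm_hausdorff R R^o) lUj (ellU j)).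
  apply: (ler_cvg_to (cU i) rU); apply: nearW => k; exact: c_le_compl_residual.
- move=> i; have : lam k.+1 i 0 * compl_residual P r k @[k --> U] --> 0.
    by apply: cvg0_mul_bounded rU; apply: nearW => k; apply: lamB.
  by apply: squeeze0; apply: nearW => k; apply: lam_c_le.
Qed.

End BoundedPenalty.

Section UnboundedPenalty.
Hypothesis sigma_pinfty : sigma k @[k --> \oo] --> +oo.

(** At these steps [sigma k * d k <= d k `^ (1 - alpha)]. *)
Let short k := x k.+1 == x k \/ sigma k <= d k `^ (- alpha).

Lemma eps_gt0 k : 0 < eps k.
Proof.
elim: k => [|k IH]; first by case: hrun => -[_ []].
have [_ _ _ + _] := hrun.2 k; rewrite /step4; case: ifP => _.
  by case=> _ _ -> _ _.
case=> _ _ -> _ _; case: ifP => // _.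
by rewrite mulr_gt0 //; case/andP: (a_beta01 a).
Qed.

(** Without short steps the counter [I1] never grows, so it can be reset at most
    once, and [eps] is eventually constant. *)
Lemma eps_eventually_constant N : (forall k, (N <= k)%N -> ~ short k) ->
  exists k1, (N <= k1)%N /\ forall k, (k1 <= k)%N -> eps k = eps k1.
Proof.
move=> ns.
have J1E k : (N <= k)%N -> (x k.+1 != x k) && (sigma k.+1 == d k `^ (- alpha)) = false.
  move=> Nk; apply/negP => /andP[_ /eqP sE]; apply: (ns k Nk); right.
  by rewrite -sE; case: (sigma_gt0_incr hrun k).
have stay k : (N <= k)%N -> I1 k = 0%N -> I1 k.+1 = 0%N /\ eps k.+1 = eps k.
  move=> Nk I0; have [_ _ _ + _] := hrun.2 k; rewrite /step4; case: ifP => _.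
    by case=> _ _ -> _ ->.
  case=> _ _ -> _ ->; have aN := a_N_gt0 a; rewrite J1E // I0 leqn0 (gtn_eqF aN) andbF.
  by split.
have noreset k : (N <= k)%N -> I1 k.+1 != 0%N -> eps k.+1 = eps k.
  move=> Nk; have [_ _ _ + _] := hrun.2 k; rewrite /step4; case: ifP => _.
    by case=> _ _ -> _ ->.
  by case=> _ _ -> _ ->; case: ifP.
have [[k1 [Nk1 I0]]|nI0] := pselect (exists k, (N <= k)%N /\ I1 k = 0%N).
  exists k1; split=> // k /subnK <-; elim: (k - k1)%N => // j IH.
  have Ij i : I1 (i + k1) = 0%N.
    elim: i => // i IHi; rewrite addSn.
    by have [] := stay (i + k1)%N (leq_trans Nk1 (leq_addl _ _)) IHi.
  rewrite addSn -IH.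
  by have [] := stay (j + k1)%N (leq_trans Nk1 (leq_addl _ _)) (Ij j).
exists N; split=> // k /subnK <-; elim: (k - N)%N => // j IH.
rewrite addSn noreset ?leq_addl //; apply/eqP => I0; apply: nI0.
by exists (j + N).+1; split=> //; rewrite leqW // leq_addl.
Qed.

(** Without them the factor [etabar] would be applied only when
    [d k `^ alpha >= eps k], hence finitely often once [eps] is constant, and
    [sigma] would stay bounded. *)
Lemma short_infinitely_often N : exists2 k, (N <= k)%N & short k.
Proof.
apply: contrapT => hn; have ns k : (N <= k)%N -> ~ short k.
  by move=> Nk sk; apply: hn; exists k.
have [k1 [Nk1 epsE]] := eps_eventually_constant ns.
have dal : d k `^ alpha @[k --> \oo] --> 0.
  apply: powR_cvg_zero alpha_gt0 (step_length_ge0 r) _.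
  exact: step_cvg0_pinfty hrun hbounded sigma_pinfty.
have e20 : 0 < eps k1 / 2 by rewrite divr_gt0 // eps_gt0.
have [N1 _ H1] := (cvgrPdist_le _ _).1 dal _ e20.
pose k2 := maxn k1 N1.
have const k : (k2 <= k)%N -> sigma k.+1 = sigma k.
  rewrite geq_max => /andP[k1k N1k].
  have nsk := ns k (leq_trans Nk1 k1k).
  have [_ _ _ + _] := hrun.2 k; rewrite /step4; case: ifP => _; first by case.
  case=> + _ _ _ _; case: ifP => [xx|_]; first by case: nsk; left.
  have := H1 k N1k; rewrite /= sub0r normrN ger0_norm ?powR_ge0 // => dle.
  rewrite leNgt (epsE k k1k).
  have -> : d k `^ alpha < eps k1.
    by apply: le_lt_trans dle _; have := eps_gt0 k1; lra.
  rewrite /= mul1r => ->; apply/max_idPr.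
  by rewrite leNgt; apply/negP => /ltW sl; case: nsk; right.
have constE j : sigma (j + k2) = sigma k2.
  by elim: j => // j IH; rewrite addSn const ?leq_addl.
have [N2 _ H2] := (cvgryPgt _).1 sigma_pinfty (sigma k2).
have := H2 (N2 + k2)%N (leq_addr _ _).
by rewrite /= constE ltxx.
Qed.

Lemma short_ultra : exists U : set_system nat,
  [/\ UltraFilter U, \oo `<=` U & sigma k * d k @[k --> U] --> 0].
Proof.
have [U [UU WU]] := ultraFilterLemma (within_proper short_infinitely_often).
have nU : \oo `<=` U.
  by move=> S oS; apply: WU; apply: filterS oS => k.
exists U; split=> //.
have a1 : 0 < 1 - alpha by rewrite subr_gt0; case/andP: (a_alpha01 a).
have dal : d k `^ (1 - alpha) @[k --> \oo] --> 0.
  apply: powR_cvg_zero a1 (step_length_ge0 r) _.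
  exact: step_cvg0_pinfty hrun hbounded sigma_pinfty.
apply: (squeeze0 _ (cvg_finer nU dal)); apply: WU.
apply: nearW => k [xx|sk].
  move: xx; rewrite -step_length_eq0 => /eqP ->.
  by rewrite mulr0 normr0 powR_ge0.
have s0 := sigma_gt0 hrun k.
have d0 : 0 < d k.
  rewrite lt_def step_length_ge0 andbT; apply/eqP => d0.
  move: sk; rewrite d0 powRN powR0 ?gt_eqF ?alpha_gt0 // invr0; lra.
rewrite ger0_norm ?mulr_ge0 ?(ltW s0) ?(ltW d0) //.
rewrite powRD ?gt_eqF ?implybT // powRr1 ?(ltW d0) // mulrC.
by rewrite ler_pM2l.
Qed.

Section AlongShortSteps.
Variables (U : set_system nat) (xs : 'cV[R]_n).
Context {UU : UltraFilter U}.
Hypothesis nU : \oo `<=` U.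
Hypothesis xU : x k @[k --> U] --> xs.
Hypothesis sdU : sigma k * d k @[k --> U] --> 0.

Let PU : ProperFilter U. Proof. exact: ultra_proper. Qed.

Let dU : d k @[k --> U] --> 0.
Proof. exact: cvg_finer nU (step_cvg0_pinfty hrun hbounded sigma_pinfty). Qed.

Let rhoU : rho k @[k --> U] --> +oo.
Proof. by move=> S /((sigma_rho_pinfty hrun).1 sigma_pinfty); apply: nU. Qed.

(** What remains of the variational inequality beside the multiplier terms stays
    bounded. *)
Lemma VI_bound y : C y -> exists M : R, \forall k \near U,
  0 <= M + dotv (mu k.+1) (A *m (y - x k.+1))
         + \sum_i lam k.+1 i 0 * (c y i 0 - c (x k.+1) i 0).
Proof.
move=> Cy; have [M [M0 Hg _ _ _]] := data_bounded P hbounded.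
have [B HB] := x_bounded hbounded; have [Bs HBs] := s_bounded hrun hbounded.
pose By := \sum_i `|y i 0| + B.
have yxB k i : `|(y - x k.+1) i 0| <= By.
  rewrite !mxE; apply: le_trans (ler_normB _ _) _; apply: lerD => //.
  by rewrite (bigD1 i) //= lerDl sumr_ge0.
exists (`|g y| + M + n%:R * (Bs * By) + n%:R * (1 * By)).
have : \forall k \near U, forall i,
    `|(sigma k *: (Q k *m (x k.+1 - x k))) i 0| <= 1.
  apply: filter_forall => i.
  have q0 : sigma k *: (Q k *m (x k.+1 - x k)) @[k --> U] --> (0 : 'cV[R]_n).
    exact: (@proximal_term_cvg0 _ _ _ _ _ _ _ hrun _ _ sdU).
  move/cvg_colP: q0 => /(_ i) /cvgrPdist_le /(_ 1 ltr01); apply: filterS => k.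
  by rewrite mxE sub0r normrN.
apply: filterS => k qk; have := run_VI hrun k Cy.
have := dotv_bound qk (yxB k); have := dotv_bound (HBs k) (yxB k).
have := Hg k.+1; have := ler_norm (g y).
rewrite !ler_norml => h1 /andP[h2 h3] /andP[h4 h5] /andP[h6 h7].
lra.
Qed.

Lemma v_ell_bound : exists B : R, forall k k', `|dotv (v k) (ell P (x k'))| <= B.
Proof.
have [M [M0 _ _ _ Hl]] := data_bounded P hbounded.
exists (p%:R * (enorm (v 0) * M)) => k k'.
by apply: dotv_bound => [i|i]; [apply: (v_bounded hrun)|apply: Hl].
Qed.

(** The product is negative only where [c < 0], and there the multiplier is at
    most the bounded [u]. *)
Lemma lam_c_ge : exists2 B : R, 0 <= B & forall k i, - B +
  rho k * Num.max 0 (c (x k.+1) i 0) ^+ 2 <= lam k.+1 i 0 * c (x k.+1) i 0.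
Proof.
have [M [M0 _ _ Hc _]] := data_bounded P hbounded.
exists (enorm (u 0) * M) => [|k i]; first by rewrite mulr_ge0 // enorm_ge0.
have r0 := rho_gt0 hrun k; have u0 := u_ge0 hrun k i.
have uU := le_trans (ler_norm _) (u_bounded hrun k i).
have := Hc i k.+1; rewrite ler_norml => /andP[cl cu].
rewrite (lamE hrun); set z := c (x k.+1) i 0 in cl cu *.
have uM : u k i 0 * M <= enorm (u 0) * M by rewrite ler_wpM2r.
have [z0|z0] := leP z 0.
  rewrite expr0n mulr0 addr0.
  have m0 : 0 <= Num.max 0 (u k i 0 + rho k * z) by rewrite le_max lexx.
  have mu : Num.max 0 (u k i 0 + rho k * z) <= u k i 0.
    by rewrite ge_max u0 gerDl mulr_ge0_le0 // ltW.
  by move: mu m0; move: (Num.max _ _) => w mu m0; nra.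
have rz : 0 <= rho k * z by rewrite mulr_ge0 // ltW.
rewrite (max_idPr _) ?addr_ge0 // expr2.
have : 0 <= u k i 0 * z by rewrite mulr_ge0 // ltW.
have : 0 <= u k i 0 * M by rewrite mulr_ge0.
lra.
Qed.

(** Tested with a feasible point, the inequality bounds [rho] times the squared
    violation of the constraints. *)
Lemma unbounded_feasible : feasible P !=set0 -> feasible P xs.
Proof.
move=> [y [Ay cy Cy]]; have [M HM] := VI_bound Cy.
have [Bv HBv] := v_ell_bound; have [Bc Bc0 HBc] := lam_c_ge.
pose B := M + Bv + m%:R * Bc.
pose viol k := dotv (ell P (x k.+1)) (ell P (x k.+1))
  + \sum_i Num.max 0 (c (x k.+1) i 0) ^+ 2.
have violB : \forall k \near U, `|viol k| <= B * (rho k)^-1.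
  apply: filterS HM => k hk; have r0 := rho_gt0 hrun k.
  have v0 : 0 <= viol k.
    by rewrite addr_ge0 ?dotv_ge0 // sumr_ge0 // => i _; rewrite sqr_ge0.
  rewrite ger0_norm // ler_pdivlMr //.
  have Ayx : A *m (y - x k.+1) = - ell P (x k.+1).
    by rewrite mulmxBr Ay /ell opprB.
  have suml : \sum_i lam k.+1 i 0 * (c y i 0 - c (x k.+1) i 0) <=
      m%:R * Bc - rho k * \sum_i Num.max 0 (c (x k.+1) i 0) ^+ 2.
    rewrite -sumr_const_ord mulr_sumr -sumrB; apply: ler_sum => i _.
    have := HBc k i; have := mulr_ge0_le0 (lam_ge0 hrun k i) (cy i); lra.
  have := HBv k k.+1; rewrite ler_norml => /andP[h1 h2].
  move: hk; rewrite Ayx dotvNr (muE hrun) dotvDl dotvZl => hk.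
  by rewrite /viol /B; lra.
have violU : viol k @[k --> U] --> 0.
  apply: (squeeze0 violB); suff : B * (rho k)^-1 @[k --> U] --> B * 0.
    by rewrite mulr0.
  by apply: cvgM; [apply: cvg_cst|apply: cvg_inv_pinfty].
have x1U : x k.+1 @[k --> U] --> xs by apply: next_cvg xU dU.
split=> [|i|]; last exact: (limit_in_C hrun xU dU).
- have lU : ell P (x k.+1) @[k --> U] --> ell P xs.
    by apply: cvgB; [apply: cvg_mulmx|apply: cvg_cst].
  have llU : dotv (ell P (x k.+1)) (ell P (x k.+1)) @[k --> U] -->
      dotv (ell P xs) (ell P xs) by apply: cvg_dotv.
  apply/eqP; rewrite -subr_eq0 -[_ - _]/(ell P xs) -dotv_eq0 eq_le dotv_ge0 andbT.
  apply: (ler_cvg_to llU violU); apply: nearW => k.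
  by rewrite lerDl sumr_ge0 // => i _; rewrite sqr_ge0.
- have cU : c (x k.+1) i 0 @[k --> U] --> c xs i 0.
    exact: (cvg_convexf (c_convexf P i) x1U).
  have mU : Num.max 0 (c (x k.+1) i 0) @[k --> U] --> 0.
    apply: cvg_sqr0; apply: squeeze0 violU; apply: nearW => k.
    rewrite ger0_norm ?sqr_ge0 // /viol (bigD1 i) //= addrCA lerDl.
    rewrite addr_ge0 ?dotv_ge0 //; by rewrite sumr_ge0 // => j _; rewrite sqr_ge0.
  apply: (ler_cvg_to cU mU); apply: nearW => k.
  by rewrite le_max lexx orbT.
Qed.

(** At the Slater point each inequality multiplier has a negative coefficient
    that does not depend on the iteration. *)
Lemma lam_bounded_of_Slater : mSCQ P ->
  forall i, exists B : R, \forall k \near U, `|lam k.+1 i 0| <= B.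
Proof.
move=> [y [Cy cy Ay _]] i; have [M HM] := VI_bound Cy.
have [Bv HBv] := v_ell_bound; have [Bc Bc0 HBc] := lam_c_ge.
exists ((M + Bv + m%:R * Bc) / - c y i 0).
apply: filterS HM => k hk; rewrite ger0_norm ?(lam_ge0 hrun) //.
rewrite ler_pdivlMr ?oppr_gt0 //.
have r0 := rho_gt0 hrun k.
have Ayx : A *m (y - x k.+1) = - ell P (x k.+1).
  by rewrite mulmxBr Ay /ell opprB.
have suml : \sum_i lam k.+1 i 0 * (c y i 0 - c (x k.+1) i 0) <=
    m%:R * Bc + lam k.+1 i 0 * c y i 0.
  apply: (@le_trans _ _ (\sum_i (Bc + lam k.+1 i 0 * c y i 0))).
    apply: ler_sum => j _; have := HBc k j.
    have : 0 <= rho k * Num.max 0 (c (x k.+1) j 0) ^+ 2.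
      by rewrite mulr_ge0 ?sqr_ge0 // ltW.
    lra.
  rewrite big_split /= sumr_const_ord lerD2l (bigD1 i) //= gerDl.
  by apply: sumr_le0 => j _; rewrite mulr_ge0_le0 ?(lam_ge0 hrun) // ltW.
have := HBv k k.+1; rewrite ler_norml => /andP[h1 h2].
have : 0 <= rho k * dotv (ell P (x k.+1)) (ell P (x k.+1)).
  by rewrite mulr_ge0 ?dotv_ge0 // ltW.
move: hk; rewrite Ayx dotvNr (muE hrun) dotvDl dotvZl; lra.
Qed.

(** Testing with points of [C] whose residuals are small multiples of the unit
    vectors and of their opposites. *)
Lemma mu_bounded_of_Slater : mSCQ P ->
  forall j, exists B : R, \forall k \near U, `|mu k.+1 j 0| <= B.
Proof.
move=> sl j; have lamB := lam_bounded_of_Slater sl.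
have [_ [_ _ _ int0]] := sl.
have [Bv HBv] := v_ell_bound; have [Bc Bc0 HBc] := lam_c_ge.
have side (z : R) : `|z| = 1 -> exists B : R, \forall k \near U, z * mu k.+1 j 0 <= B.
  move=> z1.
  have [t t0 [y Cy ly]] : exists2 t : R, 0 < t &
      (ell P @` C) (- (t * z) *: delta_mx j 0).
    move: int0 => /nbhs_ballP[t /= t0 tC]; exists (t / 2); first by rewrite divr_gt0.
    apply: tC; rewrite -ball_normE /= sub0r scaleNr opprK.
    rewrite normrZ normrM z1 mulr1 gtr0_norm ?divr_gt0 //.
    have dn : `|delta_mx j 0 : 'cV[R]_p| <= 1.
      rewrite /Num.norm /= mx_normrE; apply: bigmax_le => // i _.
      by rewrite mxE normr_nat lern1 leq_b1.
    apply: (@le_lt_trans _ _ (t / 2)); last by lra.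
    by rewrite -[leRHS]mulr1 ler_pM2l // divr_gt0.
  have [M HM] := VI_bound Cy.
  have [Bl HBl] := choice lamB.
  pose Ml := \sum_i Bl i * `|c y i 0|.
  exists ((M + Bv + Ml + m%:R * Bc) / t).
  have lamU : \forall k \near U, forall i, `|lam k.+1 i 0| <= Bl i.
    exact: filter_forall.
  apply: filterS2 HM lamU => k hk lk; rewrite ler_pdivlMr //.
  have r0 := rho_gt0 hrun k.
  have Ayx : A *m (y - x k.+1) = ell P y - ell P (x k.+1).
    by rewrite /ell opprB addrA subrK mulmxBr.
  have suml : \sum_i lam k.+1 i 0 * (c y i 0 - c (x k.+1) i 0) <= Ml + m%:R * Bc.
    rewrite -sumr_const_ord -big_split; apply: ler_sum => i _ /=.
    have := HBc k i.
    have : 0 <= rho k * Num.max 0 (c (x k.+1) i 0) ^+ 2.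
      by rewrite mulr_ge0 ?sqr_ge0 // ltW.
    have : lam k.+1 i 0 * c y i 0 <= Bl i * `|c y i 0|.
      by apply: le_trans (ler_norm _) _; rewrite normrM ler_wpM2r.
    lra.
  have muj : dotv (mu k.+1) (ell P y) = - (t * z) * mu k.+1 j 0.
    rewrite ly dotvZr dotvE (bigD1 j) //= big1 => [|i ij].
      by rewrite !mxE !eqxx mulr1 addr0.
    by rewrite mxE (negbTE ij) mulr0.
  have := HBv k k.+1; rewrite ler_norml => /andP[h1 h2].
  have : 0 <= rho k * dotv (ell P (x k.+1)) (ell P (x k.+1)).
    by rewrite mulr_ge0 ?dotv_ge0 // ltW.
  move: hk; rewrite Ayx dotvBr muj [X in _ - X](_ : _ =
    dotv (v k) (ell P (x k.+1)) + rho k * dotv (ell P (x k.+1)) (ell P (x k.+1))).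
    lra.
  by rewrite (muE hrun) dotvDl dotvZl.
have [B1 HB1] := side 1 (normr1 _).
have [B2 HB2] := side (-1) (normrN1 _).
exists (`|B1| + `|B2|); apply: filterS2 HB1 HB2 => k h1 h2.
have := ler_norm B1; have := ler_norm B2.
have := normr_ge0 B1; have := normr_ge0 B2.
by rewrite ler_norml => *; apply/andP; split; lra.
Qed.

(** At an inactive constraint [rho * c] tends to minus infinity while [u] is
    bounded, so that the multiplier is eventually 0. *)
Lemma lam_c_cvg0 : feasible P xs ->
  (forall i, exists B : R, \forall k \near U, `|lam k.+1 i 0| <= B) ->
  forall i, lam k.+1 i 0 * c (x k.+1) i 0 @[k --> U] --> 0.
Proof.
move=> [_ cxs _] lamB i.
have cU : c (x k.+1) i 0 @[k --> U] --> c xs i 0.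
  exact: (cvg_convexf (c_convexf P i) (next_cvg xU dU)).
have := cxs i; rewrite le_eqVlt => /orP[/eqP c0|c0].
  by rewrite c0 in cU; have [B HB] := lamB i; apply: cvg0_mul_bounded HB cU.
pose z := - c xs i 0 / 2; have z0 : 0 < z by rewrite divr_gt0 // oppr_gt0.
have H1 : \forall k \near U, `|c xs i 0 - c (x k.+1) i 0| <= z.
  by move/cvgrPdist_le: cU; apply.
have H2 : \forall k \near U, enorm (u 0) / z <= rho k.
  by move/cvgryPge: rhoU; apply.
apply: (@squeeze0 _ _ _ _ _ (fun=> 0)); last exact: cvg_cst.
apply: filterS2 H1 H2 => k; rewrite ler_norml => /andP[c1 c2].
rewrite ler_pdivrMr // => rk.
suff -> : lam k.+1 i 0 = 0 by rewrite mul0r normr0.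
rewrite (lamE hrun); apply/max_idPl.
have uU := le_trans (ler_norm _) (u_bounded hrun k i).
have cz : c (x k.+1) i 0 <= - z by rewrite /z in c1 c2 *; lra.
have : rho k * c (x k.+1) i 0 <= rho k * - z by rewrite ler_pM2l // (rho_gt0 hrun).
by rewrite mulrN; lra.
Qed.

End AlongShortSteps.

Lemma unbounded_case : feasible P !=set0 ->
  exists xs, [/\ cluster (x k @[k --> \oo]) xs, feasible P xs &
    mSCQ P ->
    exists ls ms, generalized_KKT P xs ls ms /\
      exists J : set nat, infinite_set J /\ converges_along r J xs ls ms].
Proof.
move=> hf; have [U [UU nU sdU]] := short_ultra.
have [B HB] := x_bounded hbounded.
have [|xs xU] := @ultra_cvg_bounded_col _ _ U UU _ x.
  by move=> i; exists B; apply: nearW => k; apply: HB.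
have feas : feasible P xs by apply: (unbounded_feasible nU xU sdU hf).
exists xs; split=> [||sl]; [exact: limit_cluster nU xU|exact: feas|].
have lamB i : exists B : R, \forall k \near U, `|lam k.+1 i 0| <= B.
  by apply: (lam_bounded_of_Slater sdU sl).
have dU : d k @[k --> U] --> 0.
  exact: cvg_finer nU (step_cvg0_pinfty hrun hbounded sigma_pinfty).
apply: (KKT_of_limit hrun hbounded nU xU dU sdU) => //.
  by move=> j; apply: (mu_bounded_of_Slater sdU sl).
by move=> i; apply: (lam_c_cvg0 nU xU feas lamB).
Qed.

End UnboundedPenalty.
End Cases.

Unset Implicit Arguments.
Set Strict Implicit.

Theorem theorem3p10 (R : realType) (n m p : nat) (P : dcProblem R n m p)
    (a : psALMDC_param R n) (r : iterates R n m p)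
    (hrun : psALMDC_generates P a r)
    (hbounded : bounded_fun (r_x r))
    (hfeasible : feasible P !=set0) :
  [/\ (* the two "or, equivalently" clauses *)
      (bounded_fun (r_sigma r : nat -> R^o) <->
         bounded_fun (r_rho r : nat -> R^o)) /\
      (r_sigma r k @[k --> \oo] --> +oo <-> r_rho r k @[k --> \oo] --> +oo),
      (* (i) *)
      bounded_fun (r_sigma r : nat -> R^o) ->
        forall xs, cluster (r_x r k @[k --> \oo]) xs ->
          exists ls ms, generalized_KKT P xs ls ms /\
            exists J : set nat, infinite_set J /\ converges_along r J xs ls ms
    & (* (ii) *)
      r_sigma r k @[k --> \oo] --> +oo ->
        exists xs, [/\ cluster (r_x r k @[k --> \oo]) xs, feasible P xs &
          mSCQ P ->
          exists ls ms, generalized_KKT P xs ls ms /\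
            exists J : set nat, infinite_set J /\ converges_along r J xs ls ms]].
Proof.
split.
- split; [exact: bounded_sigma_rho hrun|exact: sigma_rho_pinfty hrun].
- by move=> sb xs; apply: (bounded_case hrun hbounded sb).
- by move=> sy; apply: (unbounded_case hrun hbounded sy hfeasible).
Qed.
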